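(* Let $\{\lambda_i\}_{i\ge1}$ be the sequence of positive eigenvalues of $-\Delta_{W,V}$, listed in nondecreasing order and counted according to multiplicity. Then there exists $\rho\in(0,\tfrac12]$ such that $$C\,n^{1/\rho}\le\lambda_n\quad\text{for all }n\ge1$$ for some constant $C>0$. Moreover, $$\sum_{i=1}^\infty\frac1{\lambda_i^s}<\infty\quad\text{for }s>\rho.$$ In particular, if $s>\rho$, then $(I-\Delta_{W,V})^{-s}$ is a trace-class operator on $L^2_V(\mathbb{T})$.
   Context: Setting. $\mathbb{T}=\mathbb{R}/\mathbb{Z}$, identified with $[0,1)$ with tagged point $0$. $W,V:\mathbb{R}\to\mathbb{R}$ are strictly increasing, $W$ càdlàg (right-continuous with left limits), $V$ càglàd (left-continuous with right limits), with $W(x+1)-W(x)=W(1)-W(0)$ and $V(x+1)-V(x)=V(1)-V(0)$ for all $x$; both are continuous at $0$ and $W(0)=V(0)=0$. They induce finite Borel measures with $dW((a,b])=W(b)-W(a)$, $dV([a,b))=V(b)-V(a)$ (atoms allowed). $L^2_V(\mathbb{T})=L^2(\mathbb{T},dV)$, and $L^2_{V,0}(\mathbb{T})$ is its mean-zero subspace. Laplacian: the domain $\mathcal{D}_{W,V}(\mathbb{T})$ is the set of $f\in L^2_V(\mathbb{T})$ with $f(x)=a+bW(x)+\int_{(0,x]}\int_{[0,y)}\mathfrak{f}(s)\,dV(s)\,dW(y)$ $V$-a.e. for some $a,b\in\mathbb{R}$, $\mathfrak{f}\in L^2_{V,0}(\mathbb{T})$ with $bW(1)+\int_{(0,1]}\int_{[0,y)}\mathfrak{f}\,dV\,dW(y)=0$;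 then $\Delta_{W,V}f=\mathfrak{f}$. The operator $\Delta_{W,V}$ is self-adjoint in $L^2_V(\mathbb{T})$, $I-\Delta_{W,V}$ has compact inverse, and the eigenvalues of $-\Delta_{W,V}$ are $0=\lambda_0<\lambda_1\le\lambda_2\le\cdots\to\infty$ ($\lambda_0=0$ corresponds to the constants). *)

(* Defs.v *)
From HB Require Import structures.
From mathcomp Require Import all_boot all_order all_algebra.
From mathcomp Require Import all_classical all_reals all_analysis.
From mathcomp Require Import measurable_realfun.

Set Implicit Arguments.
Unset Strict Implicit.
Unset Printing Implicit Defensive.
Import Order.TTheory GRing.Theory Num.Theory.
Import numFieldNormedType.Exports.

Local Open Scope classical_set_scope.
Local Open Scope ring_scope.

(* Left-continuous counterpart of the library's [cumulative] and
   [lebesgue_stieltjes_measure].  One-sided limits of the opposite kind exist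
   automatically for monotone functions, so [cumulative R R] and
   [lcumulative R] are the nondecreasing cadlag and caglad functions. *)
HB.mixin Record isLeftCumulative (R : realType) (f : R -> R) := {
  lcumulative_nondecreasing : {homo f : x y / x <= y} ;
  lcumulative_left_continuous : forall x, f @ x^'- --> f x }.

#[short(type=lcumulative)]
HB.structure Definition LeftCumulative (R : realType) :=
  { f of isLeftCumulative R f }.

Section left_stieltjes.
Context {R : realType}.

Definition reflect (V : R -> R) : R -> R := fun x => - V (- x).

Lemma reflect_nondecreasing (V : lcumulative R) :
  {homo reflect V : x y / x <= y}.
Proof.
by move=> x y xy; rewrite lerN2; apply: lcumulative_nondecreasing; rewrite lerN2.
Qed.

Lemma reflect_right_continuous (V : lcumulative R) :
  right_continuous (reflect V).
Proof.
move=> x; apply: cvgN; apply/cvgrPdist_lt => e e0.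
have /cvgrPdist_lt/(_ e e0) := @lcumulative_left_continuous R V (- x).
rewrite !near_withinE => /nbhs_ballP[d /= d0 h]; apply/nbhs_ballP.
exists d => // y; rewrite /ball/= => xy ltxy; apply: h; rewrite ?ltrN2//.
by rewrite /ball/= -opprD normrN.
Qed.

HB.instance Definition _ (V : lcumulative R) :=
  isCumulative.Build R _ R (reflect V)
    (@reflect_nondecreasing V) (@reflect_right_continuous V).

Definition opp_measurableTypeR (x : measurableTypeR R) : measurableTypeR R :=
  - (x : R).

Lemma measurable_opp_measurableTypeR : measurable_fun setT opp_measurableTypeR.
Proof. exact: (@oppr_measurable R setT). Qed.

(* The measure dV: the image under x |-> - x of the Lebesgue-Stieltjes measure
   of the right-continuous function x |-> - V (- x). *)
Definition left_stieltjes_measure (V : lcumulative R) :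
    set (measurableTypeR R) -> \bar R :=
  pushforward (lebesgue_stieltjes_measure (reflect V)) opp_measurableTypeR.

Section left_stieltjes_is_measure.
Variable V : lcumulative R.
Let mu := left_stieltjes_measure V.
Let nu : {measure set (measurableTypeR R) -> \bar R} :=
  lebesgue_stieltjes_measure (reflect V).

Let mpre (A : set (measurableTypeR R)) : measurable A ->
  measurable (opp_measurableTypeR @^-1` A).
Proof.
by move=> mA; rewrite -[X in measurable X]setTI; exact: measurable_opp_measurableTypeR.
Qed.

Let mu0 : mu set0 = 0%E.
Proof. by rewrite /mu /left_stieltjes_measure /pushforward preimage_set0 measure0. Qed.

Let mu_ge0 A : (0 <= mu A)%E.
Proof. exact: (measure_ge0 nu). Qed.

Let mu_sigma_additive : semi_sigma_additive mu.
Proof.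
move=> F mF tF mUF; rewrite /mu /left_stieltjes_measure /pushforward preimage_bigcup.
apply: (@measure_semi_sigma_additive _ _ _ nu).
- by move=> n; exact: mpre.
- apply/trivIsetP => /= i j _ _ ij; rewrite -preimage_setI.
  by move/trivIsetP : tF => /(_ _ _ _ _ ij) ->//; rewrite preimage_set0.
- by rewrite -preimage_bigcup; exact: mpre.
Qed.

HB.instance Definition _ := isMeasure.Build _ _ _ (left_stieltjes_measure V)
  mu0 mu_ge0 mu_sigma_additive.
End left_stieltjes_is_measure.

Lemma left_stieltjes_measure_itv (V : lcumulative R) (a b : R) : a <= b ->
  left_stieltjes_measure V `[a, b[%classic = (V b - V a)%:E.
Proof.
move=> ab; rewrite /left_stieltjes_measure /pushforward.
rewrite (_ : _ @^-1` _ = `]- b, - a]%classic); last first.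
  apply/seteqP; split => x; rewrite /= !in_itv/= /opp_measurableTypeR.
    by move=> /andP[ax xb]; rewrite ltrNl xb lerNr ax.
  by move=> /andP[bx xa]; rewrite lerNr xa ltrNl bx.
rewrite /lebesgue_stieltjes_measure /measure_extension measurable_mu_extE/=; last first.
  exact: is_ocitv.
by rewrite wlength_itv_bnd ?lerN2// /reflect !opprK addrC.
Qed.

End left_stieltjes.

(* Operators on L2.  The elements of L2 are represented by square-integrable
   functions, equality in L2 being equality almost everywhere. *)
Section L2_operators.
Context d (T : measurableType d) (R : realType).
Variable mu : {measure set T -> \bar R}.

Definition L2 := LfunType mu (lee1n 2 : (1 <= 2%:R%:E :> \bar R)%E).

Implicit Types (f g : L2) (A P : L2 -> L2).

Definition inner f g : R := \int[mu]_x (f x * g x).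

Definition L2norm f : R := fine ('N[mu]_2%:E [EFin \o f])%E.

Definition orthonormal_seq (e : nat -> L2) :=
  forall i j, inner (e i) (e j) = (i == j)%:R.

Definition orthonormal_basis (e : nat -> L2) :=
  orthonormal_seq e /\
  forall f, (forall i, inner f (e i) = 0) -> f = (0 : L2) %[ae mu].

Definition bounded_operator A :=
  (forall a f g, A (a *: f + g) = a *: A f + A g %[ae mu]) /\
  exists M : R, forall f,
    L2norm (A f) <= M * L2norm f.

Definition positive_operator A :=
  (forall f g, inner (A f) g = inner f (A g)) /\ forall f, 0 <= inner (A f) f.

(* P = |A| = (A^* A)^(1/2): the identity P^2 = A^* A is expressed through the
   bilinear form of its two sides, P being self-adjoint. *)
Definition is_absolute_value A P :=
  [/\ bounded_operator P, positive_operator P &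
      forall f g, inner (P f) (P g) = inner (A f) (A g)].

Definition trace_class A :=
  bounded_operator A /\
  exists2 P, is_absolute_value A P &
    forall e, orthonormal_basis e ->
      (\sum_(0 <= k <oo) (inner (P (e k)) (e k))%:E < +oo)%E.

(* The set of classes of elements of E is a vector space of dimension n. *)
Definition has_dimension (E : set L2) (n : nat) :=
  exists b : 'I_n -> L2,
    [/\ forall i, E (b i),
        forall c : 'I_n -> R, \sum_i c i *: b i = (0 : L2) %[ae mu] ->
          forall i, c i = 0 &
        forall f, E f <-> exists c : 'I_n -> R, f = \sum_i c i *: b i %[ae mu]].

End L2_operators.

Section Laplacian.
Context {R : realType}.
Variables (W : cumulative R R) (V : lcumulative R).

Local Notation dW := (lebesgue_stieltjes_measure W).
Local Notation dV := (left_stieltjes_measure V).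

(* The measure dV on the torus, identified with [0, 1[. *)
Definition torus_measure : {measure set (measurableTypeR R) -> \bar R} :=
  mrestr dV (measurable_itv `[0%R, 1%R[).

Definition L2V := L2 torus_measure.

(* f belongs to the domain and its Laplacian is g. *)
Definition is_laplacian (f g : L2V) :=
  let G y := \int[dV]_(s in `[0%R, y[) g s in
  \int[torus_measure]_x g x = 0 /\
  exists a b : R,
    b * W 1 + \int[dW]_(y in `]0%R, 1%R]) G y = 0 /\
    {ae torus_measure, forall x,
      f x = a + b * W x + \int[dW]_(y in `]0%R, x]) G y}.

Definition laplacian_eigenspace (mu : R) : set L2V :=
  [set f | is_laplacian f (- mu *: f)].

(* lam lists the eigenvalues 0 = lam 0 < lam 1 <= lam 2 <= ...; the positive
   ones are repeated according to multiplicity. *)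
Definition eigenvalue_sequence (lam : nat -> R) :=
  [/\ lam 0%N = 0,
      forall i, (0 < i)%N -> 0 < lam i,
      forall i j, (0 < i <= j)%N -> lam i <= lam j &
      forall mu, 0 < mu -> exists2 n : nat,
        ([set i | lam i = mu] #= `I_n)%card & has_dimension (laplacian_eigenspace mu) n].

(* A = (I - Delta)^(-s), given by the functional calculus
   A f = \sum_i (1 + lam i)^(-s) <f, nu_i> nu_i in L2, where the nu_i are
   orthonormal and - Delta nu_i = (lam i) nu_i.  When lam is an
   eigenvalue_sequence it exhausts the spectrum with multiplicities (the kernel
   of Delta consists of the constants), so the nu_i form a basis of L2 because
   I - Delta has a compact inverse. *)
Definition is_resolvent_power (lam : nat -> R) (s : R) (A : L2V -> L2V) :=
  exists nu : nat -> L2V,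
    [/\ orthonormal_seq nu,
        forall i, laplacian_eigenspace (lam i) (nu i) &
        forall f,
          L2norm (A f -
            \sum_(i < n) ((1 + lam i) `^ (- s) * inner f (nu i)) *: nu i)
          @[n --> \oo] --> (0 : R)].

End Laplacian.

(* Main.v *)
(* One may take [rho = 1/2], because [lam N >= N^2 / S^2] with [S = W 1 + V 1].
   Write [f = a + int_(]0, x]) F dW], [F = b + int_([0, y[) g dV], for a function
   [f] of the domain with Laplacian [g].  Fubini's theorem gives
   [<f1, - g2> = int F1 F2 dW], so that eigenfunctions of distinct eigenvalues
   are orthogonal, and the span of [N + 1] orthonormal eigenfunctions
   [nu_0, ..., nu_N] contains some [f <> 0] that vanishes at [N] prescribed
   points.  Choosing the points so that [W + V] grows by at most [S / N] on the
   open intervals between them, Cauchy-Schwarz on each interval yields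
   [||f||^2 <= (S / N)^2 int F^2 dW <= (S / N)^2 lam_N ||f||^2].
   For [s > 1/2] the coefficients [(1 + lam i)^(-s)] are then summable, whence
   the operator exists; it is positive, thus its own absolute value, and Bessel's
   inequality bounds its trace by the sum of the coefficients. *)
Require Import Defs.
From HB Require Import structures.
From mathcomp Require Import all_boot all_order all_algebra.
From mathcomp Require Import all_classical all_reals all_analysis.
From mathcomp Require Import measurable_realfun.
From mathcomp Require Import ring lra.
Set Implicit Arguments.
Unset Strict Implicit.
Unset Printing Implicit Defensive.
Import Order.TTheory GRing.Theory Num.Theory.
Import numFieldNormedType.Exports.
Local Open Scope classical_set_scope.
Local Open Scope ring_scope.

(** * Inner products and series in L2 *)

(** The obstacle is that [dW] and [dV] may have atoms: [W + V] can jump over a prescribed level, so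
    a partition with small increments up to the end points need not exist. Half-open cells repair
    this. On [[p, q[] a potential that vanishes at [p] equals [int_(]p, t]) F dW] at [t]; its zero
    hides an atom of [dV] at [p], and [t < q] hides an atom of [dW] at [q], so that only the growth
    on the open cell counts. One factor [S / N] comes from Cauchy-Schwarz in [dW], the other from
    integrating over the cell in [dV]. Vanishing is imposed at left end points only, hence [N]
    conditions on [N + 1] coefficients. Elements of [L2] are classes, so these conditions bear on
    the everywhere defined right-hand side of the integral representation. No boundary term survives
    in Fubini's theorem: [g2] has mean zero, which removes the constant [a] of [f1], and [F1] has
    mean zero for [dW], which makes the constant in [F2] free. *)

Section inner_product.
Context d (T : measurableType d) (R : realType).
Variable mu : {measure set T -> \bar R}.
Implicit Types (f g h : L2 mu) (a : R).

Lemma integrable_inner f g : mu.-integrable setT (EFin \o (f \* g)).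
Proof.
by apply/Lfun1_integrable/Lfun2_mul_Lfun1; exact: LfunP.
Qed.

Lemma innerC f g : inner f g = inner g f.
Proof. by apply: eq_Rintegral => x _; rewrite mulrC. Qed.

Lemma inner_linearl a f g h : inner (a *: f + g) h = a * inner f h + inner g h.
Proof.
rewrite /inner -RintegralZl//; last exact: integrable_inner.
rewrite -RintegralD//; last exact: integrable_inner.
  by apply: eq_Rintegral => x _ /=; rewrite /GRing.scale/= mulrDl mulrA.
have := integrable_inner (a *: f) h; congr (_.-integrable _ _).
by apply/funext => x /=; rewrite mulrA.
Qed.

Lemma innerDl f g h : inner (f + g) h = inner f h + inner g h.
Proof. by rewrite -[f]scale1r inner_linearl mul1r scale1r. Qed.

Lemma inner0l h : inner 0 h = 0.
Proof. by apply: (addrI (inner 0 h)); rewrite -innerDl !addr0. Qed.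

Lemma innerZl a f h : inner (a *: f) h = a * inner f h.
Proof. by rewrite -[_ *: f]addr0 inner_linearl inner0l addr0. Qed.

Lemma innerNl f h : inner (- f) h = - inner f h.
Proof. by rewrite -scaleN1r innerZl mulN1r. Qed.

Lemma innerBl f g h : inner (f - g) h = inner f h - inner g h.
Proof. by rewrite innerDl innerNl. Qed.

Lemma inner_suml I (r : seq I) (P : pred I) (F : I -> L2 mu) h :
  inner (\sum_(i <- r | P i) F i) h = \sum_(i <- r | P i) inner (F i) h.
Proof.
by elim/big_rec2 : _ => [|i x f _ <-]; rewrite ?inner0l// innerDl.
Qed.

Lemma innerZr a f h : inner h (a *: f) = a * inner h f.
Proof. by rewrite innerC innerZl innerC. Qed.

Lemma innerBr f g h : inner h (f - g) = inner h f - inner h g.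
Proof. by rewrite innerC innerBl !(innerC h). Qed.

Lemma inner_sumr I (r : seq I) (P : pred I) (F : I -> L2 mu) h :
  inner h (\sum_(i <- r | P i) F i) = \sum_(i <- r | P i) inner h (F i).
Proof. by rewrite innerC inner_suml; apply: eq_bigr => i _; rewrite innerC. Qed.

Lemma inner_ge0 f : 0 <= inner f f.
Proof. by apply: Rintegral_ge0 => x _; rewrite -expr2 sqr_ge0. Qed.

Lemma eq_innerl f g h : f = g %[ae mu] -> inner f h = inner g h.
Proof.
move=> fg; congr fine; apply: ae_eq_integral => //.
- by case/integrableP : (integrable_inner f h).
- by case/integrableP : (integrable_inner g h).
- by apply: filterS fg => x /= fgx _; rewrite fgx.
Qed.

Lemma L2normE f : L2norm f = Num.sqrt (inner f f).
Proof.
have n0 : 0 <= L2norm f by exact/fine_ge0/Lnorm_ge0.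
rewrite -[LHS]ger0_norm// -sqrtr_sqr; congr Num.sqrt.
rewrite -powR_mulrn// /L2norm -fine_poweR powR_Lnorm//; congr fine.
by apply: eq_integral => x _ /=; rewrite powR_mulrn// -normrX ger0_norm ?sqr_ge0.
Qed.

Lemma L2norm_sqr f : L2norm f ^+ 2 = inner f f.
Proof. by rewrite L2normE sqr_sqrtr// inner_ge0. Qed.

Lemma L2norm_ge0 f : 0 <= L2norm f.
Proof. by rewrite L2normE. Qed.

Lemma inner_eq0 f : inner f f = 0 -> f = (0 : L2 mu) %[ae mu].
Proof. by move=> f0; apply: fine_Lnormr_eq0; have := L2normE f; rewrite f0 sqrtr0. Qed.

(** The squared norm of [<g, g> f - <f, g> g] is [<g, g>] times the discriminant, so no division
    occurs; a [g] of norm zero is replaced by 0 almost everywhere. *)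
Lemma cauchy_schwarz f g : `|inner f g| <= L2norm f * L2norm g.
Proof.
have [g0|g0] := eqVneq (inner g g) 0.
  rewrite innerC (eq_innerl f (inner_eq0 g0)) inner0l normr0.
  by rewrite mulr_ge0// L2norm_ge0.
have gp : 0 < inner g g by rewrite lt_def g0 inner_ge0.
rewrite !L2normE -sqrtrM ?inner_ge0// -sqrtr_sqr ler_sqrt; last first.
  by rewrite mulr_ge0 ?inner_ge0.
have := inner_ge0 (inner g g *: f - inner f g *: g).
rewrite !(innerBl, innerBr, innerZl, innerZr) (innerC g f).
set A := inner f f; set B := inner f g; set C := inner g g.
rewrite (_ : _ - _ = C * (A * C - B ^+ 2)); last by ring.
by rewrite pmulr_rge0// subr_ge0.
Qed.

Lemma L2norm0 : L2norm (0 : L2 mu) = 0.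
Proof. by rewrite L2normE inner0l sqrtr0. Qed.

Lemma L2normZ a f : L2norm (a *: f) = `|a| * L2norm f.
Proof.
by rewrite !L2normE innerZl innerZr mulrA -expr2 sqrtrM ?sqr_ge0// sqrtr_sqr.
Qed.

Lemma L2normD f g : L2norm (f + g) <= L2norm f + L2norm g.
Proof. exact: ler_LnormD. Qed.

Section orthonormal.
Variables (n : nat) (e : 'I_n -> L2 mu).
Hypothesis eP : forall i j, inner (e i) (e j) = (i == j)%:R.

Lemma inner_orthonormal_sum (c b : 'I_n -> R) :
  inner (\sum_i c i *: e i) (\sum_i b i *: e i) = \sum_i c i * b i.
Proof.
rewrite inner_suml; apply: eq_bigr => i _; rewrite innerZl; congr (_ * _).
rewrite inner_sumr (bigD1 i)//= innerZr eP eqxx mulr1 big1 ?addr0// => j ji.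
by rewrite innerZr eP eq_sym (negbTE ji) mulr0.
Qed.

(** The squared distance from [f] to its projection [p] is [<f, f> - s]. *)
Lemma bessel f : \sum_i inner f (e i) ^+ 2 <= inner f f.
Proof.
set s := \sum_i _.
pose p := \sum_i inner f (e i) *: e i.
have pp : inner p p = s by rewrite inner_orthonormal_sum.
have fp : inner f p = s.
  by rewrite inner_sumr; apply: eq_bigr => i _; rewrite innerZr.
have := inner_ge0 (f - p).
by rewrite innerBl !innerBr (innerC p f) pp fp subrr subr0 subr_ge0.
Qed.

End orthonormal.

End inner_product.

Section L2_series.
Context d (T : measurableType d) (R : realType).
Variable mu : {measure set T -> \bar R}.

Lemma L2_sumE I (r : seq I) (P : pred I) (F : I -> L2 mu) x :
  (\sum_(i <- r | P i) F i) x = \sum_(i <- r | P i) F i x.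
Proof. by elim/big_rec2 : _ => // i y f _ <-. Qed.

Lemma Lfun2P (f : T -> R) : measurable_fun setT f ->
  (\int[mu]_x (f x ^+ 2)%:E < +oo)%E -> f \in Lfun mu 2%:R%:E.
Proof.
move=> mf foo; rewrite inE; apply/andP; split; rewrite inE//=.
rewrite /finite_norm unlock poweR_lty//; apply: le_lt_trans foo.
rewrite le_eqVlt; apply/orP; left; apply/eqP/eq_integral => x _ /=.
by rewrite powR_mulrn// -normrX ger0_norm ?sqr_ge0.
Qed.

Lemma integral_sqr (f : L2 mu) : (\int[mu]_x (f x ^+ 2)%:E = (inner f f)%:E)%E.
Proof.
rewrite /inner /Rintegral fineK; last first.
  exact: (integrable_fin_num measurableT (integrable_inner f f)).
by apply: eq_integral => x _; rewrite expr2.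
Qed.

(** Puts the absolute value back in [L2], so that Minkowski's inequality applies to sums of absolute
    values. *)
Lemma L2_abs_subproof (f : L2 mu) : Num.norm \o f \in Lfun mu 2%:R%:E.
Proof.
apply: Lfun2P; first exact: measurableT_comp.
rewrite (eq_integral (fun x => (f x ^+ 2)%:E)) ?integral_sqr ?ltry// => x _ /=.
by rewrite -normrX ger0_norm// sqr_ge0.
Qed.

Definition L2_abs (f : L2 mu) : L2 mu := Lfun_Sub (lee1n 2) (L2_abs_subproof f).

Lemma L2norm_abs (f : L2 mu) : L2norm (L2_abs f) = L2norm f.
Proof.
rewrite !L2normE; congr Num.sqrt; apply: eq_Rintegral => x _ /=.
by rewrite -normrM ger0_norm// -expr2 sqr_ge0.
Qed.

Lemma L2norm_sum n (F : 'I_n -> L2 mu) :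
  L2norm (\sum_i F i) <= \sum_i L2norm (F i).
Proof.
elim/big_rec2 : _ => [|i y f _ h]; first by rewrite L2norm0.
by rewrite (le_trans (L2normD _ _))// lerD2l.
Qed.

(* Riesz-Fischer: [S] is the square of the sum of the [|g i|]; it is integrable
   by Minkowski and monotone convergence, so that it bounds the partial sums
   almost everywhere and dominates the squares of the remainders. *)
Lemma L2_series_cvg (g : nat -> L2 mu) (M : R) :
  (forall n, \sum_(i < n) L2norm (g i) <= M) ->
  exists h : L2 mu, L2norm (h - \sum_(i < n) g i) @[n --> \oo] --> (0 : R).
Proof.
move=> gM.
pose u n x : R := \sum_(i < n) g i x.
pose a n x : R := \sum_(i < n) `|g i x|.
have a0 n x : 0 <= a n x by exact: sumr_ge0.
have nda x : nondecreasing_seq (a ^~ x).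
  by apply/nondecreasing_seqP => n; rewrite /a big_ord_recr/= lerDl.
have ndG x : nondecreasing_seq (fun n => (a n x ^+ 2)%:E).
  by move=> m n mn; rewrite lee_fin lerXn2r ?nnegrE// nda.
pose S x : \bar R := limn (fun n => (a n x ^+ 2)%:E).
have cS x : (a n x ^+ 2)%:E @[n --> \oo] --> S x.
  by apply: ereal_nondecreasing_is_cvgn.
have aS n x : ((a n x ^+ 2)%:E <= S x)%E.
  apply: lime_ge; first by apply/cvg_ex; exists (S x); exact: cS.
  by exists n => // m /= nm; exact: ndG.
have ma n : measurable_fun setT (a n).
  by apply: measurable_sum => i; exact: measurableT_comp.
have mG n : measurable_fun setT (fun x => (a n x ^+ 2)%:E).
  by apply/measurable_EFinP; exact: measurable_funX.
have mS : measurable_fun setT S by apply: (emeasurable_fun_cvg _ _ mG) => x _; exact: cS.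
have S0 x : (0 <= S x)%E by apply: le_trans (aS 0%N x); rewrite lee_fin sqr_ge0.
have M0 : 0 <= M by have := gM 0%N; rewrite big_ord0.
have iS : (\int[mu]_x S x <= (M ^+ 2)%:E)%E.
  rewrite /S monotone_convergence//; last by move=> n x _; rewrite lee_fin sqr_ge0.
  apply: lime_le.
    apply: ereal_nondecreasing_is_cvgn => m n mn; apply: ge0_le_integral => //.
    - by move=> x _; rewrite lee_fin sqr_ge0.
    - by move=> x _; exact: ndG.
  apply: nearW => n.
  rewrite (eq_integral (fun x => ((\sum_(i < n) L2_abs (g i)) x ^+ 2)%:E)); last first.
    by move=> x _; rewrite L2_sumE.
  rewrite integral_sqr lee_fin -L2norm_sqr lerXn2r ?nnegrE ?L2norm_ge0//.
  rewrite (le_trans (L2norm_sum _))//; apply: le_trans (gM n).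
  by apply: ler_sum => i _; rewrite L2norm_abs.
have intS : mu.-integrable setT S.
  apply/integrableP; split => //.
  under eq_integral => x _ do rewrite gee0_abs//.
  by rewrite (le_lt_trans iS)// ltry.
pose D := [set x | (S x < +oo)%E].
have mD : measurable D.
  by rewrite -[D]setTI; exact: emeasurable_fun_infty_o.
have aeD : {ae mu, forall x, D x}.
  have := integrable_ae measurableT intS; apply: filterS => x /= /(_ I).
  by rewrite ge0_fin_numE.
have uD x : D x -> cvgn (u ^~ x).
  move=> Dx; have Sx : S x \is a fin_num by rewrite ge0_fin_numE.
  suff cax : cvgn (a ^~ x).
    have : cvgn [normed series (fun i => g i x)].
      rewrite (_ : [normed series _] = a ^~ x)//.
      by apply/funext => n; rewrite /normed_series_of seriesEord.
    move=> /normed_cvg; rewrite (_ : series _ = u ^~ x)//.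
    by apply/funext => n; rewrite seriesEord.
  apply: nondecreasing_is_cvgn => //.
  exists (Num.sqrt (fine (S x))) => _ [n _ <-].
  rewrite -(ger0_norm (a0 n x)) -sqrtr_sqr ler_wsqrtr//.
  by rewrite -lee_fin fineK.
(* The cut-off by [\1_D] makes the sequence converge at every point, which gives the measurability
   of [h]. *)
pose h x : R := limn (fun n => u n x * \1_D x).
have ch x : u n x * \1_D x @[n --> \oo] --> h x.
  have [Dx|Dx] := pselect (D x).
    by apply: is_cvgM; [exact: uD|exact: is_cvg_cst].
  by rewrite /h indicE memNset//; under eq_fun do rewrite mulr0; exact: is_cvg_cst.
have mu_ n : measurable_fun setT (u n) by apply: measurable_sum => i.
have mh : measurable_fun setT h.
  apply: (@measurable_fun_cvg _ _ _ _ (fun n x => u n x * \1_D x)).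
    by move=> n; apply: measurable_funM.
  by move=> x _; exact: ch.
have ua n x : `|u n x| <= a n x by exact: ler_norm_sum.
have chD x : D x -> u n x @[n --> \oo] --> h x.
  by move=> Dx; have := ch x; rewrite indicE mem_set//; under eq_fun do rewrite mulr1.
have u2S n x : ((u n x ^+ 2)%:E <= S x)%E.
  by apply: le_trans (aS n x); rewrite lee_fin -real_normK ?num_real// lerXn2r ?nnegrE.
have h2S x : D x -> ((h x ^+ 2)%:E <= S x)%E.
  move=> Dx; have Sx : S x \is a fin_num by rewrite ge0_fin_numE.
  rewrite -(fineK Sx) lee_fin.
  have c2 : u n x ^+ 2 @[n --> \oo] --> h x ^+ 2.
    by rewrite expr2; under eq_fun do rewrite expr2; apply: cvgM; exact: chD.
  rewrite -(cvg_lim _ c2)//; apply: limr_le; first by apply/cvg_ex; eexists; exact: c2.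
  by apply: nearW => n; rewrite -lee_fin fineK.
have hL : h \in Lfun mu 2%:R%:E.
  apply: Lfun2P => //; apply: le_lt_trans (_ : \int[mu]_x S x < _)%E.
    apply: ae_ge0_le_integral => //.
    - by move=> x _; rewrite lee_fin sqr_ge0.
    - by apply/measurable_EFinP; exact: measurable_funX.
    - by apply: filterS aeD => x Dx _; exact: h2S.
  by rewrite (le_lt_trans iS)// ltry.
exists (Lfun_Sub (lee1n 2) hL); set H := Lfun_Sub _ hL.
suff : inner (H - \sum_(i < n) g i) (H - \sum_(i < n) g i) @[n --> \oo] --> (0 : R).
  move=> c; rewrite -(sqrtr0 R); under eq_fun do rewrite L2normE.
  by apply: continuous_cvg => //; exact: sqrt_continuous.
suff : (\int[mu]_x ((h x - u n x) ^+ 2)%:E @[n --> \oo] --> \int[mu]_x (cst 0 x))%E.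
  rewrite integral0 => /fine_cvgP[_]/=; apply: cvg_trans; apply: near_eq_cvg.
  apply: nearW => n /=; congr fine; apply: eq_integral => x _.
  by rewrite -expr2 (_ : (H - _) x = h x - (\sum_(i < n) g i) x)// L2_sumE.
(* Both [h^2] and [u^2] are at most [S] on [D], whence [(h - u)^2 <= 2 h^2 + 2 u^2 <= 4 S]. *)
have [|||||_ _] := @dominated_convergence _ _ _ mu setT measurableT
  (fun n x => ((h x - u n x) ^+ 2)%:E) (cst 0%E) (fun x => 4%:E * S x)%E.
- by move=> n; apply/measurable_EFinP/measurable_funX/measurable_funB.
- by [].
- apply: filterS aeD => x Dx _; apply: cvg_EFin; first by near=> n.
  rewrite [X in _ --> X](_ : _ = (h x - h x) ^+ 2); last by rewrite subrr expr0n.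
  rewrite expr2; under [X in X @ _]eq_fun do rewrite /= expr2.
  by apply: cvgM; apply: cvgB; (exact: cvg_cst || exact: chD).
- exact: integrableZl.
- apply: filterS aeD => x Dx n _ /=.
  have Sx : S x \is a fin_num by rewrite ge0_fin_numE.
  have := h2S x Dx; have := u2S n x.
  rewrite -(fineK Sx) -EFinM !lee_fin ger0_norm ?sqr_ge0//.
  by move=> h1 h2; have := sqr_ge0 (h x + u n x); nra.
- by [].
Unshelve. all: end_near.
Qed.

End L2_series.

(** * Operators diagonal in an orthonormal family *)

(** The rank is at most [m < n]. This serves twice: to find a vector orthogonal to those already
    chosen, and to make a combination of eigenfunctions vanish at the mesh points. *)
Lemma exists_left_kernel (F : fieldType) (m n : nat) (M : 'M[F]_(n, m)) :
  (m < n)%N -> exists2 c : 'rV[F]_n, c != 0 & c *m M = 0.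
Proof.
move=> mn; exists (nz_row (kermx M)).
  rewrite nz_row_eq0 -mxrank_eq0 mxrank_ker -lt0n subn_gt0.
  exact: leq_ltn_trans (rank_leq_col M) mn.
exact/sub_kermxP/nz_row_sub.
Qed.

(** Cauchy condensation: the [2 ^ k] terms with index from [2 ^ k] to [2 ^ k.+1] are each at most
    [(2 ^ k)^(-p)], so that the block contributes at most [r ^+ k] with [r = 2^(1 - p) < 1]. *)
Lemma sum_powRN_bounded (R : realType) (p : R) : 1 < p ->
  exists M, forall n, \sum_(i < n) (i.+1%:R `^ p)^-1 <= M.
Proof.
move=> p1; pose r : R := 2 `^ (1 - p).
have r0 : 0 < r by rewrite powR_gt0.
have r1 : r < 1.
  have p10 : 0 < p - 1 by rewrite subr_gt0.
  rewrite /r -opprB powRN invf_lt1 ?powR_gt0//.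
  have := @gt0_ltr_powR R _ p10 1 2; rewrite powR1; apply; rewrite ?nnegrE//.
  by rewrite ltr1n.
have sub1r0 : 0 < 1 - r by rewrite subr_gt0.
(* The bound is one plus the sum of the [r ^+ j] for [j < k], in closed form. *)
have dyadic k :
    \sum_(0 <= i < 2 ^ k) (i.+1%:R `^ p)^-1 <= 1 + (1 - r ^+ k) / (1 - r).
  elim: k => [|k IH].
    by rewrite expn0 big_nat1 powR1 invr1 expr0 subrr mul0r addr0.
  rewrite (big_cat_nat (n := 2 ^ k))//=; last by rewrite leq_exp2l.
  have -> : 1 + (1 - r ^+ k.+1) / (1 - r) = 1 + (1 - r ^+ k) / (1 - r) + r ^+ k.
    by rewrite exprS; field; rewrite gt_eqF.
  rewrite lerD//.
  have -> : r ^+ k = \sum_(2 ^ k <= i < 2 ^ k.+1) ((2 ^ k)%:R `^ p)^-1.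
    rewrite big_const_nat iter_addr_0 expnS mul2n -addnn addnK.
    have -> : (2 ^ k)%:R `^ p = (2 `^ p) ^+ k :> R.
      rewrite natrX -[in LHS](powR_mulrn k (ler0n R 2)).
      by rewrite -powRrM mulrC powRrM powR_mulrn// powR_ge0.
    rewrite /r powRB ?pnatr_eq0 ?implybT// powRr1// expr_div_n -natrX.
    by rewrite mulr_natl.
  rewrite !big_nat; apply: ler_sum => i /andP[ki _].
  rewrite lef_pV2 ?posrE ?powR_gt0 ?ltr0n ?expn_gt0//.
  rewrite ge0_ler_powR ?nnegrE ?ler0n ?ler_nat ?(ltW (lt_trans ltr01 p1))//.
  exact: leqW.
exists (1 + (1 - r)^-1) => n.
rewrite -(big_mkord xpredT (fun i => (i.+1%:R `^ p)^-1)).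
apply: le_trans (_ : \sum_(0 <= i < 2 ^ n) (i.+1%:R `^ p)^-1 <= _).
  rewrite [leRHS](big_cat_nat (n := n))//=; last exact/ltnW/ltn_expl.
  by rewrite lerDl sumr_ge0// => i _; rewrite invr_ge0 powR_ge0.
apply: le_trans (dyadic n) _; rewrite lerD2l ler_pdivrMr// mulVf ?gt_eqF//.
by rewrite gerBl exprn_ge0// ltW.
Qed.

Lemma nneseries_le_bound (R : realType) (u : nat -> R) (m : nat) (M : R) :
  (forall i, 0 <= u i) -> (forall n, \sum_(m <= i < n) u i <= M) ->
  (\sum_(m <= i <oo) (u i)%:E <= M%:E)%E.
Proof.
move=> u0 uM; apply: lime_le.
  by apply: is_cvg_nneseries => n _ _; rewrite lee_fin.
by apply: nearW => n; rewrite sumEFin lee_fin.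
Qed.

Section diagonal_operator.
Context d (T : measurableType d) (R : realType).
Variable mu : {measure set T -> \bar R}.

(** Gram-Schmidt by counting dimensions: while [m < n], the [m] orthogonality conditions on the [n]
    coefficients have a nonzero solution, and freeness gives the resulting vector a positive
    norm. *)
Lemma exists_orthonormal_family (E : set (L2 mu)) (n : nat) (b : 'I_n -> L2 mu) :
  E 0 -> (forall a f g, E f -> E g -> E (a *: f + g)) ->
  (forall i, E (b i)) ->
  (forall c : 'I_n -> R, \sum_i c i *: b i = (0 : L2 mu) %[ae mu] ->
    forall i, c i = 0) ->
  forall m, (m <= n)%N -> exists e : nat -> L2 mu,
    (forall i, (i < m)%N -> E (e i)) /\
    (forall i j, (i < m)%N -> (j < m)%N -> inner (e i) (e j) = (i == j)%:R).
Proof.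
move=> E0 EL Eb free; elim=> [_|m IH mn]; first by exists (fun=> 0); split.
have [e [Ee oe]] := IH (ltnW mn).
have [c c0 ck] := exists_left_kernel (\matrix_(i, j) inner (b i) (e (j : 'I_m))) mn.
pose v := \sum_i c 0 i *: b i.
have Ev : E v.
  rewrite /v; elim/big_rec : _ => // i x _ Ex; exact: EL.
have ve i : (i < m)%N -> inner v (e i) = 0.
  move=> im; have := congr1 (fun A : 'rV_m => A 0 (Ordinal im)) ck.
  rewrite !mxE => <-; rewrite inner_suml; apply: eq_bigr => j _.
  by rewrite innerZl mxE.
have vv : 0 < inner v v.
  rewrite lt_def inner_ge0 andbT; apply: contra c0 => /eqP/inner_eq0 v0.
  by apply/eqP/rowP => i; rewrite mxE (free _ v0).
pose w := (Num.sqrt (inner v v))^-1 *: v.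
have ww : inner w w = 1.
  rewrite innerZl innerZr mulrA -expr2 exprVn sqr_sqrtr ?inner_ge0//.
  by rewrite mulVf// gt_eqF.
have we i : (i < m)%N -> inner w (e i) = 0 by move=> im; rewrite innerZl ve ?mulr0.
exists (fun i => if (i < m)%N then e i else w); split=> [i|i j].
  by rewrite ltnS; case: ltnP => [/Ee//|_ _]; rewrite /w -[_ *: _]addr0; exact: EL.
rewrite !ltnS; case: ltnP => im; case: ltnP => jm.
- by move=> _ _; exact: oe.
- by move=> _ _; rewrite innerC we// ltn_eqF// (leq_trans im).
- by move=> _ _; rewrite we// gtn_eqF// (leq_trans jm).
- move=> im' jm'; rewrite ww; suff -> : i = j by rewrite eqxx.
  by apply/eqP; rewrite eqn_leq (leq_trans im' jm) (leq_trans jm' im).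
Qed.

Variables (nu : nat -> L2 mu) (c : nat -> R) (M : R).
Hypotheses (onu : orthonormal_seq nu) (c0 : forall i, 0 <= c i).
Hypothesis cM : forall n, \sum_(i < n) c i <= M.

Let partial f n : L2 mu := \sum_(i < n) (c i * inner f (nu i)) *: nu i.

Lemma normr_inner_nu f i : `|inner f (nu i)| <= L2norm f.
Proof.
apply: le_trans (cauchy_schwarz _ _) _.
by rewrite [L2norm (nu i)]L2normE onu eqxx sqrtr1 mulr1.
Qed.

Lemma diagonal_operator_exists f :
  exists h : L2 mu, L2norm (h - partial f n) @[n --> \oo] --> (0 : R).
Proof.
apply: (@L2_series_cvg _ _ _ mu (fun i => (c i * inner f (nu i)) *: nu i)
  (M * L2norm f)) => n.
apply: le_trans (_ : \sum_(i < n) c i * L2norm f <= _).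
  apply: ler_sum => i _; rewrite L2normZ [L2norm (nu i)]L2normE onu eqxx sqrtr1.
  by rewrite mulr1 normrM ger0_norm// ler_wpM2l// normr_inner_nu.
by rewrite -mulr_suml ler_wpM2r// L2norm_ge0.
Qed.

Variable A : L2 mu -> L2 mu.
Hypothesis AP : forall f, L2norm (A f - partial f n) @[n --> \oo] --> (0 : R).

(** Norm convergence implies weak convergence; the properties of [A] below are read off this limit
    of bilinear forms. *)
Lemma inner_diagonal_cvg f g :
  \sum_(i < n) c i * (inner f (nu i) * inner g (nu i)) @[n --> \oo] -->
  inner (A f) g.
Proof.
apply/cvgrPdist_le => e e0.
(* Adding 1 keeps the divisor positive when [g] has norm zero. *)
have g1 : 0 < L2norm g + 1 by rewrite ltr_pwDr// L2norm_ge0.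
have := AP f => /cvgrPdist_le/(_ _ (divr_gt0 e0 g1)); apply: filterS => n.
rewrite sub0r normrN ger0_norm ?L2norm_ge0// ler_pdivlMr// => h.
have -> : \sum_(i < n) c i * (inner f (nu i) * inner g (nu i)) =
    inner (partial f n) g.
  rewrite inner_suml; apply: eq_bigr => i _.
  by rewrite innerZl mulrA (innerC g).
rewrite -innerBl (le_trans (cauchy_schwarz _ _))//; apply: le_trans h.
by rewrite ler_wpM2l ?L2norm_ge0// lerDl.
Qed.

Lemma diagonal_operator_sym f g : inner (A f) g = inner f (A g).
Proof.
rewrite [RHS]innerC; apply: (cvg_unique _ (@inner_diagonal_cvg f g)) => //.
have := @inner_diagonal_cvg g f.
by under eq_fun do under eq_bigr do rewrite (mulrC (inner g _)).
Qed.

Lemma diagonal_operator_ge0 f : 0 <= inner (A f) f.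
Proof.
rewrite -(cvg_lim _ (@inner_diagonal_cvg f f))//; apply: limr_ge.
  by apply/cvg_ex; eexists; exact: inner_diagonal_cvg.
by apply: nearW => n; apply: sumr_ge0 => i _; rewrite mulr_ge0// -expr2 sqr_ge0.
Qed.

(** Since [A] is known only through limits, symmetry is used to move it to the other argument, where
    linearity is that of the inner product; testing with the difference of both sides shows that it
    is null. *)
Lemma diagonal_operator_linear a f g :
  A (a *: f + g) = a *: A f + A g %[ae mu].
Proof.
have AD h : inner (A (a *: f + g)) h = inner (a *: A f + A g) h.
  by rewrite diagonal_operator_sym !inner_linearl -!diagonal_operator_sym.
set x := A _ in AD *; set y := _ + _ in AD *.
have /inner_eq0 : inner (x - y) (x - y) = 0 by rewrite innerBl AD subrr.
by apply: filterS => t /= /(_ I) h _; apply/subr0_eq.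
Qed.

(** Testing against [A f] bounds [||A f||^2] by [M ||f|| ||A f||], and one factor [||A f||]
    cancels. *)
Lemma diagonal_operator_bounded f : L2norm (A f) <= M * L2norm f.
Proof.
have M0 : 0 <= M by have := cM 0%N; rewrite big_ord0.
have [->|] := eqVneq (L2norm (A f)) 0; first by rewrite mulr_ge0 ?L2norm_ge0.
move=> Af0; have Af : 0 < L2norm (A f) by rewrite lt_def Af0 L2norm_ge0.
rewrite -(ler_pM2r Af) -expr2 L2norm_sqr -(cvg_lim _ (@inner_diagonal_cvg f (A f)))//.
apply: limr_le; first by apply/cvg_ex; eexists; exact: inner_diagonal_cvg.
apply: nearW => n; rewrite -mulrA.
apply: le_trans (_ : \sum_(i < n) c i * (L2norm f * L2norm (A f)) <= _).
  apply: ler_sum => i _; rewrite ler_wpM2l// (le_trans (ler_norm _))// normrM.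
  by rewrite ler_pM// normr_inner_nu.
by rewrite -mulr_suml ler_wpM2r// mulr_ge0// L2norm_ge0.
Qed.

(* Summing first over the basis, Bessel's inequality bounds the trace by the
   sum of the [c i]. *)
Lemma diagonal_operator_trace (e : nat -> L2 mu) : orthonormal_seq e ->
  (\sum_(0 <= k <oo) (inner (A (e k)) (e k))%:E <= M%:E)%E.
Proof.
move=> oe; apply: nneseries_le_bound => [k|N]; first exact: diagonal_operator_ge0.
rewrite big_mkord.
have cS : \sum_(k < N) \sum_(i < n) c i * (inner (e k) (nu i) * inner (e k) (nu i))
    @[n --> \oo] --> \sum_(k < N) inner (A (e k)) (e k).
  by apply: cvg_big => [|k _]; [exact: add_continuous|exact: inner_diagonal_cvg].
rewrite -(cvg_lim _ cS)//; apply: limr_le; first by apply/cvg_ex; eexists; exact: cS.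
apply: nearW => n; apply: le_trans (cM n); rewrite exchange_big/=.
apply: ler_sum => i _; rewrite -mulr_sumr -[leRHS]mulr1 ler_wpM2l//.
have := bessel (fun k l : 'I_N => oe k l) (nu i).
rewrite onu eqxx; apply: le_trans; rewrite le_eqVlt; apply/orP; left.
by apply/eqP/eq_bigr => k _; rewrite innerC expr2.
Qed.

Lemma diagonal_operator_trace_class : trace_class A.
Proof.
have bA : bounded_operator A.
  split; first exact: diagonal_operator_linear.
  by exists M; exact: diagonal_operator_bounded.
split => //; exists A; last first.
  by move=> e [oe _]; rewrite (le_lt_trans (diagonal_operator_trace oe))// ltry.
split => //; split; first exact: diagonal_operator_sym.
exact: diagonal_operator_ge0.
Qed.

End diagonal_operator.

(** * Green's identity *)

Section kernel_fubini.
Context d1 d2 (T1 : measurableType d1) (T2 : measurableType d2) (R : realType).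
Variables (m1 : {finite_measure set T1 -> \bar R}).
Variables (m2 : {finite_measure set T2 -> \bar R}).
Variables (h1 : T1 -> R) (h2 : T2 -> R) (A : set (T1 * T2)).
Hypotheses (ih1 : m1.-integrable setT (EFin \o h1)).
Hypotheses (ih2 : m2.-integrable setT (EFin \o h2)) (mA : measurable A).

Let mkA : measurable_fun setT (\1_A : T1 * T2 -> R).
Proof. exact: measurable_indic. Qed.

Let k z : R := h1 z.1 * h2 z.2 * \1_A z.

Let mh1 : measurable_fun setT h1.
Proof. by case/integrableP : ih1 => /measurable_EFinP. Qed.

Let mh2 : measurable_fun setT h2.
Proof. by case/integrableP : ih2 => /measurable_EFinP. Qed.

Let mk : measurable_fun setT k.
Proof.
apply: measurable_funM; last exact: measurable_indic.
by apply: measurable_funM; apply: measurableT_comp.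
Qed.

Let normr_k z : `|k z| <= `|h1 z.1| * `|h2 z.2|.
Proof.
rewrite /k !normrM -[leRHS]mulr1 ler_wpM2l ?mulr_ge0//.
by rewrite ger0_norm// indicE; case: (_ \in _).
Qed.

Let ik2 x : m2.-integrable setT (EFin \o (fun y => k (x, y))).
Proof.
apply: (le_integrable _ _ _ (integrableZl measurableT (h1 x) ih2)) => //.
  by apply/measurable_EFinP; exact: (measurableT_comp mk).
by move=> y _ /=; rewrite lee_fin [leRHS]normrM; exact: normr_k.
Qed.

Let ik1 y : m1.-integrable setT (EFin \o (fun x => k (x, y))).
Proof.
apply: (le_integrable _ _ _ (integrableZl measurableT (h2 y) ih1)) => //.
  by apply/measurable_EFinP; exact: (measurableT_comp mk).
by move=> x _ /=; rewrite lee_fin [leRHS]normrM mulrC; exact: normr_k.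
Qed.

(** The kernel is dominated by [|h1| |h2|], whose iterated integral is a product of two finite
    ones. *)
Let ik : (m1 \x m2)%E.-integrable setT (EFin \o k).
Proof.
apply/integrable12ltyP; first exact/measurable_EFinP.
have [_ i1] := integrableP _ _ _ ih1; have [_ i2] := integrableP _ _ _ ih2.
apply: le_lt_trans (_ : \int[m1]_x (`|h1 x|%:E * \int[m2]_y `|(h2 y)%:E|) < _)%E.
  apply: ge0_le_integral => //.
  - by move=> x _; exact: integral_ge0.
  - apply: (measurable_fun_fubini_tonelli_F (fun z => `|(k z)%:E|%E)) => //.
    by apply: measurableT_comp => //; exact/measurable_EFinP.
  - apply: emeasurable_funM => //.
    by apply/measurable_EFinP; exact: measurableT_comp.
  move=> x _; rewrite -ge0_integralZl//; last first.
    by apply: measurableT_comp => //; exact/measurable_EFinP.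
  apply: ge0_le_integral => //.
  - by apply: measurableT_comp => //; case/integrableP : (ik2 x).
  - by apply: emeasurable_funM => //; apply/measurable_EFinP; exact: measurableT_comp.
  - by move=> y _ /=; rewrite -EFinM lee_fin; exact: normr_k.
rewrite ge0_integralZr//; last 2 first.
- by apply/measurable_EFinP; exact: measurableT_comp.
- exact: integral_ge0.
rewrite lte_mul_pinfty//; first exact: integral_ge0.
rewrite ge0_fin_numE//; exact: integral_ge0.
Qed.

Let is2 x : m2.-integrable setT (EFin \o (fun y => h2 y * \1_A (x, y))).
Proof.
apply: (le_integrable _ _ _ ih2) => //.
  apply/measurable_EFinP; apply: measurable_funM => //.
  exact: (measurableT_comp mkA).
move=> y _ /=; rewrite lee_fin normrM -[leRHS]mulr1 ler_wpM2l//.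
by rewrite ger0_norm// indicE; case: (_ \in _).
Qed.

Let is1 y : m1.-integrable setT (EFin \o (fun x => h1 x * \1_A (x, y))).
Proof.
apply: (le_integrable _ _ _ ih1) => //.
  apply/measurable_EFinP; apply: measurable_funM => //.
  exact: (measurableT_comp mkA).
move=> x _ /=; rewrite lee_fin normrM -[leRHS]mulr1 ler_wpM2l//.
by rewrite ger0_norm// indicE; case: (_ \in _).
Qed.

Let fubini_FE : fubini_F m2 (EFin \o k) =
  EFin \o (fun x => h1 x * \int[m2]_y (h2 y * \1_A (x, y))).
Proof.
apply/funext => x /=; rewrite -RintegralZl//.
rewrite /fubini_F /Rintegral fineK.
  by apply: eq_integral => y _; rewrite /= mulrA.
have := integrable_fin_num measurableT (ik2 x).
by congr (_ \is a fin_num); apply: eq_integral => y _; rewrite /= mulrA.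
Qed.

Let fubini_GE : fubini_G m1 (EFin \o k) =
  EFin \o (fun y => h2 y * \int[m1]_x (h1 x * \1_A (x, y))).
Proof.
apply/funext => y /=; rewrite -RintegralZl//.
rewrite /fubini_G /Rintegral fineK.
  by apply: eq_integral => x _; rewrite /k/= mulrA (mulrC (h1 _)).
have := integrable_fin_num measurableT (ik1 y).
congr (_ \is a fin_num); apply: eq_integral => x _.
by rewrite /k/= mulrA (mulrC (h1 _)).
Qed.

(** This is also where the measurability of the primitives below comes from, with the constant 1 as
    one factor. *)
Lemma integrable_kernel1 : m1.-integrable setT
  (EFin \o (fun x => h1 x * \int[m2]_y (h2 y * \1_A (x, y)))).
Proof. by rewrite -fubini_FE; exact: integrable_fubini_F. Qed.

Lemma Rintegral_kernel_fubini :
  \int[m1]_x (h1 x * \int[m2]_y (h2 y * \1_A (x, y))) =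
  \int[m2]_y (h2 y * \int[m1]_x (h1 x * \1_A (x, y))).
Proof.
have := @Fubini _ _ _ _ _ m1 m2 _ ik.
rewrite -/(fubini_F m2 (EFin \o k)) -/(fubini_G m1 (EFin \o k)).
have -> : (\int[m1]_x \int[m2]_y (EFin \o k) (x, y))%E =
  (\int[m1]_x fubini_F m2 (EFin \o k) x)%E by [].
have -> : (\int[m2]_y \int[m1]_x (EFin \o k) (x, y))%E =
  (\int[m2]_y fubini_G m1 (EFin \o k) y)%E by [].
by rewrite fubini_FE fubini_GE /Rintegral => ->.
Qed.

End kernel_fubini.

(** * Integration by parts for a pair of finite measures *)

Section sturm_liouville.
Context {R : realType}.
Local Notation T := (measurableTypeR R).
Variables (m n : {finite_measure set T -> \bar R}).
Implicit Types (f g F : T -> R).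

(** Half-lines stand for [[0, y[] and []0, x]], the measures being later restricted to the unit
    interval. The open end here and the closed end below are the ones in the definition of the
    Laplacian. *)
Definition lprimitive g (y : R) : R := \int[m]_(x in `]-oo, y[) g x.
Definition rprimitive F (x : R) : R := \int[n]_(y in `]-oo, x]) F y.

Let A := [set z : T * T | (z.2 : R) <= (z.1 : R)].

Let mA : measurable A.
Proof.
rewrite -[A]setTI.
by apply: (@measurable_fun_le _ (T * T)%type R setT snd fst).
Qed.

Let B := [set z : T * T | (z.2 : R) < (z.1 : R)].

Let mB : measurable B.
Proof.
rewrite (_ : B = ~` [set z : T * T | (z.1 : R) <= (z.2 : R)]).
  apply: measurableC; rewrite -[X in measurable X]setTI.
  by apply: (@measurable_fun_le _ (T * T)%type R setT fst snd).
by apply/seteqP; split => z; rewrite /B/= ltNge => /negP.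
Qed.

Let lprimitiveE g y : lprimitive g y = \int[m]_x (g x * \1_B (y, x)).
Proof.
rewrite /lprimitive Rintegral_mkcond; apply: eq_Rintegral => x _.
by rewrite patch_indic/= !indicE; congr (_ * (nat_of_bool _)%:R);
  apply/idP/idP; rewrite !inE/= in_itv.
Qed.

Let rprimitiveE F x : rprimitive F x = \int[n]_y (F y * \1_A (x, y)).
Proof.
rewrite /rprimitive Rintegral_mkcond; apply: eq_Rintegral => y _.
by rewrite patch_indic/= !indicE; congr (_ * (nat_of_bool _)%:R);
  apply/idP/idP; rewrite !inE/= in_itv.
Qed.

Lemma integrable_mul_lprimitive F g : n.-integrable setT (EFin \o F) ->
  m.-integrable setT (EFin \o g) ->
  n.-integrable setT (EFin \o (fun y => F y * lprimitive g y)).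
Proof.
move=> iF ig; have := @integrable_kernel1 _ _ _ _ _ n m F g B iF ig mB.
by congr (_.-integrable _ _); apply/funext => y /=; rewrite lprimitiveE.
Qed.

Lemma integrable_lprimitive g : m.-integrable setT (EFin \o g) ->
  n.-integrable setT (EFin \o lprimitive g).
Proof.
move=> ig; have := integrable_mul_lprimitive
  (finite_measure_integrable_cst n 1 measurableT) ig.
by congr (_.-integrable _ _); apply/funext => y /=; rewrite mul1r.
Qed.

Lemma integrable_mul_rprimitive g F : m.-integrable setT (EFin \o g) ->
  n.-integrable setT (EFin \o F) ->
  m.-integrable setT (EFin \o (fun x => g x * rprimitive F x)).
Proof.
move=> ig iF; have := @integrable_kernel1 _ _ _ _ _ m n g F A ig iF mA.
by congr (_.-integrable _ _); apply/funext => x /=; rewrite rprimitiveE.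
Qed.

Lemma measurable_rprimitive F : n.-integrable setT (EFin \o F) ->
  measurable_fun setT (rprimitive F).
Proof.
move=> iF; have := integrable_mul_rprimitive
  (finite_measure_integrable_cst m 1 measurableT) iF.
case/integrableP => /measurable_EFinP + _; congr measurable_fun.
by apply/funext => x /=; rewrite mul1r.
Qed.

(** Fubini's theorem turns the primitive of [F] into the integral of [g] over [[y, +oo[]. As [g] has
    mean zero, this is minus its integral over the complementary half-line []-oo, y[]; the two ends
    are complementary, so atoms cause no correction. *)
Lemma Rintegral_green g F : m.-integrable setT (EFin \o g) ->
  n.-integrable setT (EFin \o F) -> \int[m]_x g x = 0 ->
  \int[m]_x (g x * rprimitive F x) = - \int[n]_y (F y * lprimitive g y).
Proof.
move=> ig iF g0.
have := @Rintegral_kernel_fubini _ _ _ _ _ m n g F A ig iF mA.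
under eq_Rintegral do rewrite -rprimitiveE.
move=> ->.
have igx (C : set T) : measurable C -> m.-integrable setT (EFin \o (g \_ C)).
  move=> mC; rewrite -restrict_EFin; apply/(integrable_mkcond (EFin \o g) mC).
  exact: (integrableS measurableT mC (@subsetT _ _) ig).
have igA y : \int[m]_x (g x * \1_A (x, y)) = - lprimitive g y.
  have := g0; have -> : \int[m]_x g x =
      \int[m]_x (g \_ `]-oo, (y : R)[ x + g \_ `[(y : R), +oo[ x).
    apply: eq_Rintegral => x _; rewrite !patchE !mem_setE !in_itv/= andbT.
    by case: ltP; rewrite ?addr0 ?add0r.
  rewrite RintegralD//; [|exact: igx|exact: igx].
  rewrite -Rintegral_mkcond -/(lprimitive g y) => /eqP.
  rewrite addrC addr_eq0 => /eqP <-; apply: eq_Rintegral => x _.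
  by rewrite patch_indic/= !indicE; congr (_ * (nat_of_bool _)%:R);
    apply/idP/idP; rewrite !inE/= in_itv/= andbT.
under eq_Rintegral do rewrite igA mulrN -mulN1r.
by rewrite RintegralZl ?mulN1r//; exact: integrable_mul_lprimitive.
Qed.

(** The derivative of [f] with respect to [dW]; it absorbs the linear term [b W] of the
    representation. *)
Definition flux (b : R) g (y : R) : R := b + lprimitive g y.

Lemma integrable_flux b g : m.-integrable setT (EFin \o g) ->
  n.-integrable setT (EFin \o flux b g).
Proof.
move=> ig; have := integrableD measurableT
  (finite_measure_integrable_cst n b measurableT) (integrable_lprimitive ig).
by congr (_.-integrable _ _); apply/funext => y.
Qed.

(** The product is [b2 F1 + F1 * lprimitive g2] with [F1 = flux b1 g1], and the second term is a
    kernel integral. *)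
Lemma integrable_flux_mul b1 b2 g1 g2 : m.-integrable setT (EFin \o g1) ->
  m.-integrable setT (EFin \o g2) ->
  n.-integrable setT (EFin \o (flux b1 g1 \* flux b2 g2)).
Proof.
move=> ig1 ig2; have iF := integrable_flux b1 ig1.
have := integrableD measurableT (integrableZl measurableT b2 iF)
  (integrable_mul_lprimitive iF ig2).
congr (_.-integrable _ _); apply/funext => y /=.
by rewrite -EFinM -EFinD; congr _%:E; rewrite /flux; ring.
Qed.

(* [f] lies in the domain, [a] and [b] are the constants of its integral
   representation and [g] is its Laplacian. *)
Definition representation (a b : R) g f :=
  [/\ \int[m]_x g x = 0, \int[n]_y flux b g y = 0 &
      {ae m, forall x, f x = a + rprimitive (flux b g) x}].

(** The constant [a1] disappears because [g2] has mean zero, and [lprimitive g2] may be completed to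
    [flux b2 g2] because the total flux of [f1] is zero. *)
Lemma representation_green a1 b1 g1 f1 b2 g2 :
  m.-integrable setT (EFin \o g1) -> m.-integrable setT (EFin \o g2) ->
  measurable_fun setT f1 -> representation a1 b1 g1 f1 ->
  \int[m]_x g2 x = 0 ->
  \int[m]_x (f1 x * g2 x) = - \int[n]_y (flux b1 g1 y * flux b2 g2 y).
Proof.
move=> ig1 ig2 mf1 [_ F10 f1E] g20; have iF := integrable_flux b1 ig1.
have mg2 : measurable_fun setT g2 by case/integrableP: ig2 => /measurable_EFinP.
transitivity (\int[m]_x (a1 * g2 x + g2 x * rprimitive (flux b1 g1) x)).
  congr fine; apply: ae_eq_integral => //.
  - by apply/measurable_EFinP; exact: measurable_funM.
  - apply/measurable_EFinP/measurable_funD; first exact: measurable_funM.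
    by apply: measurable_funM => //; exact: measurable_rprimitive.
  - apply: filterS f1E => x -> _; congr _%:E; ring.
rewrite RintegralD//; last 2 first.
- exact: (integrableZl measurableT a1 ig2).
- exact: integrable_mul_rprimitive.
rewrite RintegralZl// g20 mulr0 add0r Rintegral_green//; congr (- _).
transitivity (\int[n]_y (flux b1 g1 y * flux b2 g2 y + - b2 * flux b1 g1 y)).
  by apply: eq_Rintegral => y _; rewrite /flux; ring.
rewrite RintegralD//; last 2 first.
- exact: integrable_flux_mul.
- exact: (integrableZl measurableT (- b2) iF).
by rewrite RintegralZl// F10 mulr0 addr0.
Qed.

Lemma lprimitive_linear c g1 g2 y : m.-integrable setT (EFin \o g1) ->
  m.-integrable setT (EFin \o g2) ->
  lprimitive (fun x => c * g1 x + g2 x) y = c * lprimitive g1 y + lprimitive g2 y.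
Proof.
move=> i1 i2; have iS f : m.-integrable setT (EFin \o f) ->
    m.-integrable `]-oo, y[ (EFin \o f).
  by apply: integrableS.
have icg1 := iS (fun x => c * g1 x) (integrableZl measurableT c i1).
rewrite /lprimitive RintegralD//; last exact: iS.
by rewrite RintegralZl//; exact: iS.
Qed.

Lemma rprimitive_linear c F1 F2 x : n.-integrable setT (EFin \o F1) ->
  n.-integrable setT (EFin \o F2) ->
  rprimitive (fun y => c * F1 y + F2 y) x = c * rprimitive F1 x + rprimitive F2 x.
Proof.
move=> i1 i2; have iS F : n.-integrable setT (EFin \o F) ->
    n.-integrable `]-oo, x] (EFin \o F).
  by apply: integrableS.
have icF1 := iS (fun y => c * F1 y) (integrableZl measurableT c i1).
rewrite /rprimitive RintegralD//; last exact: iS.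
by rewrite RintegralZl//; exact: iS.
Qed.

Lemma flux_linear c b1 b2 g1 g2 y : m.-integrable setT (EFin \o g1) ->
  m.-integrable setT (EFin \o g2) ->
  flux (c * b1 + b2) (fun x => c * g1 x + g2 x) y = c * flux b1 g1 y + flux b2 g2 y.
Proof. by move=> i1 i2; rewrite /flux lprimitive_linear//; ring. Qed.

Lemma rprimitive_flux_linear c b1 b2 g1 g2 x :
  m.-integrable setT (EFin \o g1) -> m.-integrable setT (EFin \o g2) ->
  rprimitive (flux (c * b1 + b2) (fun x => c * g1 x + g2 x)) x =
  c * rprimitive (flux b1 g1) x + rprimitive (flux b2 g2) x.
Proof.
move=> i1 i2; rewrite -rprimitive_linear//; [|exact: integrable_flux..].
by apply: eq_Rintegral => y _; exact: flux_linear.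
Qed.

Lemma representation_linear c a1 b1 g1 f1 a2 b2 g2 f2 :
  m.-integrable setT (EFin \o g1) -> m.-integrable setT (EFin \o g2) ->
  representation a1 b1 g1 f1 -> representation a2 b2 g2 f2 ->
  representation (c * a1 + a2) (c * b1 + b2) (fun x => c * g1 x + g2 x)
    (fun x => c * f1 x + f2 x).
Proof.
move=> i1 i2 [g10 F10 f1E] [g20 F20 f2E]; split.
- rewrite RintegralD//; last exact: (integrableZl measurableT c i1).
  by rewrite RintegralZl// g10 g20 mulr0 addr0.
- have iF1 := integrable_flux b1 i1; have iF2 := integrable_flux b2 i2.
  under eq_Rintegral do rewrite flux_linear//.
  rewrite RintegralD//; last exact: (integrableZl measurableT c iF1).
  by rewrite RintegralZl// F10 F20 mulr0 addr0.
- apply: filterS2 f1E f2E => x -> ->; rewrite rprimitive_flux_linear//; ring.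
Qed.

End sturm_liouville.

Section finite_measure_of.
Context d (T : measurableType d) (R : realType).
Variables (mu : {measure set T -> \bar R}).

(* An alias of [mu] that carries a finite measure structure; when [mu] is a
   concrete measure its measure structure is convertible to that of [mu], so
   that both have the same [L2]. *)
Definition finite_measure_of & (mu setT < +oo)%E : set T -> \bar R := mu.

Hypothesis mufin : (mu setT < +oo)%E.
Local Notation fmu := (finite_measure_of mufin).

HB.instance Definition _ := Measure.on fmu.

Let fmu_fin : fin_num_fun fmu. Proof. exact: lty_fin_num_fun. Qed.

HB.instance Definition _ := Measure_isFinite.Build _ _ _ fmu fmu_fin.

End finite_measure_of.

(** The complement of [D] is null for the restricted measure, so [E] may be cut down to [D]; on
    subsets of [D] the two measures agree. *)
Lemma Rintegral_mrestr d (T : measurableType d) (R : realType)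
    (mu : {measure set T -> \bar R}) (D E : set T) (mD : measurable D)
    (f : T -> R) : measurable E -> measurable_fun setT f ->
  \int[mrestr mu mD]_(x in E) f x = \int[mu]_(x in E `&` D) f x.
Proof.
move=> mE mf; have mr (C : set T) : measurable C ->
    measurable_fun setT (EFin \o (f \_ C)).
  move=> mC; apply/measurable_EFinP; apply/(measurable_restrictT _ _).1 => //.
  exact: measurable_funS mf.
rewrite Rintegral_mkcond.
transitivity (\int[mrestr mu mD]_(x in E `&` D) f x).
  rewrite [RHS]Rintegral_mkcond; congr fine; apply: ae_eq_integral => //.
  - exact: mr.
  - by apply: mr; exact: measurableI.
  - exists (~` D); split; first exact: measurableC.
      by rewrite [LHS](_ : _ = mu (~` D `&` D))// setICl measure0.
    move=> x /= h Dx; apply: h => _; congr _%:E; rewrite !patchE in_setI.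
    by rewrite (mem_set Dx) andbT.
congr fine; apply: eq_measure_integral => A mA AED.
by rewrite [LHS](_ : _ = mu (A `&` D))// setIidl// => x /AED[].
Qed.

Lemma le_mrestr d (T : measurableType d) (R : realType)
    (mu : {measure set T -> \bar R}) (D A : set T) (mD : measurable D) :
  measurable A -> (mrestr mu mD A <= mu A)%E.
Proof.
move=> mA; rewrite /mrestr; apply: le_measure; rewrite ?inE//.
exact: measurableI.
Qed.

(** * The Laplacian of the torus in terms of two finite measures *)

Section torus.
Context {R : realType}.
Variables (W : cumulative R R) (V : lcumulative R).
Hypothesis W0 : W 0 = 0.
Local Notation T := (measurableTypeR R).
Local Notation dW := (lebesgue_stieltjes_measure W).
Local Notation dV := (left_stieltjes_measure V).

Lemma lebesgue_stieltjes_measure_itv (a b : R) : a <= b ->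
  dW `]a, b]%classic = (W b - W a)%:E.
Proof.
move=> ab; rewrite /lebesgue_stieltjes_measure /measure_extension.
by rewrite measurable_mu_extE/= ?wlength_itv_bnd//; exact: is_ocitv.
Qed.

Definition arc_measure : {measure set T -> \bar R} :=
  mrestr dW (measurable_itv `]0%R, 1%R]).

Lemma arc_measure_lty : (arc_measure setT < +oo)%E.
Proof.
by rewrite /= /mrestr setTI lebesgue_stieltjes_measure_itv// ltry.
Qed.

Lemma torus_measure_lty : (torus_measure V setT < +oo)%E.
Proof.
by rewrite /= /mrestr setTI left_stieltjes_measure_itv// ltry.
Qed.

Local Notation m := (finite_measure_of torus_measure_lty).
Local Notation n := (finite_measure_of arc_measure_lty).

Lemma Rintegral_torus (E : set T) (f : T -> R) : measurable E ->
  measurable_fun setT f ->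
  \int[m]_(x in E) f x = \int[dV]_(x in E `&` `[0%R, 1%R[) f x.
Proof. exact: (Rintegral_mrestr dV (measurable_itv `[0%R, 1%R[)). Qed.

Lemma Rintegral_arc (E : set T) (f : T -> R) : measurable E ->
  measurable_fun setT f ->
  \int[n]_(x in E) f x = \int[dW]_(x in E `&` `]0%R, 1%R]) f x.
Proof. exact: (Rintegral_mrestr dW (measurable_itv `]0%R, 1%R])). Qed.

Lemma L2V_integrable (g : L2V V) : m.-integrable setT (EFin \o g).
Proof.
apply/Lfun1_integrable; apply: Lfun_subset12; last exact: LfunP.
by rewrite ge0_fin_numE// torus_measure_lty.
Qed.

Lemma lprimitive_torus (g : L2V V) y : 0 < y <= 1 ->
  \int[dV]_(s in `[0%R, y[) g s = lprimitive m g y.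
Proof.
move=> /andP[y0 y1]; rewrite /lprimitive.
rewrite Rintegral_torus//; congr (Rintegral _ _ _).
apply/seteqP; split => s /=; rewrite !in_itv/=.
  by move=> /andP[-> sy]; rewrite sy (lt_le_trans sy).
by move=> [-> /andP[-> _]].
Qed.

Lemma rprimitive_arc (b : R) (g : L2V V) x : 0 <= x <= 1 ->
  b * W x + \int[dW]_(y in `]0%R, x]) \int[dV]_(s in `[0%R, y[) g s =
  rprimitive n (flux m b g) x.
Proof.
move=> /andP[x0 x1]; have ig := L2V_integrable g.
have ip := integrable_lprimitive n ig.
have mp : measurable_fun setT (lprimitive m g).
  by case/integrableP : ip => /measurable_EFinP.
have E0x : `]-oo, x]%classic `&` `]0%R, 1%R]%classic = `]0%R, x]%classic.
  apply/seteqP; split => y /=; rewrite !in_itv/=.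
    by move=> [-> /andP[-> _]].
  by move=> /andP[-> yx]; rewrite yx (le_trans yx).
rewrite /rprimitive /flux RintegralD//; last 2 first.
- exact: (finite_measure_integrable_cst n b).
- exact: integrableS ip.
congr (_ + _).
  rewrite Rintegral_cst//; congr (_ * _).
  transitivity (fine (dW `]0%R, x])); last by rewrite -E0x.
  by rewrite lebesgue_stieltjes_measure_itv// W0 subr0.
rewrite (Rintegral_arc (measurable_itv `]-oo, x]) mp) E0x.
apply: eq_Rintegral => y.
rewrite inE/= in_itv/= => /andP[y0 yx].
by rewrite lprimitive_torus// y0 (le_trans yx).
Qed.

Lemma ae_torus : {ae m, forall x : R, 0 <= x < 1}.
Proof.
exists (~` `[0%R, 1%R[%classic); split; first exact: measurableC.
  by rewrite [LHS](_ : _ = dV (~` `[0%R, 1%R[ `&` `[0%R, 1%R[))// setICl measure0.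
by move=> x /= h; rewrite in_itv.
Qed.

(** Almost every point for [m] lies in [[0, 1[], where the primitives on half-lines are those of the
    definition; since [n] is carried by []0, 1]], the periodicity condition says that the total flux
    is zero. *)
Lemma is_laplacianP (f g : L2V V) : is_laplacian W f g <->
  exists a b, representation m n a b g f.
Proof.
have total b : \int[n]_y flux m b g y = rprimitive n (flux m b g) 1.
  have mF : measurable_fun setT (flux m b g).
    by case/integrableP : (integrable_flux n b (L2V_integrable g)) => /measurable_EFinP.
  rewrite /rprimitive !Rintegral_arc//; congr (Rintegral _ _ _).
  apply/seteqP; split => y /=; rewrite !in_itv/=.
    by move=> [_ /andP[-> ->]].
  by move=> [_ ->].
split.
  move=> [g0 [a [b [F0 fE]]]]; exists a, b; split; first exact: g0.
    by rewrite total -rprimitive_arc// ler01 lexx.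
  apply: (@filterS2 _ _ (ae_filter_ringOfSetsType m) _ _ _ _ ae_torus fE).
  by move=> x /andP[x0 x1] ->; rewrite -addrA rprimitive_arc// x0 ltW.
move=> [a [b [g0 F0 fE]]]; split; first exact: g0.
exists a, b; split.
  have le01 : 0 <= (1 : R) <= 1 by rewrite ler01 lexx.
  by rewrite (rprimitive_arc b g le01); exact: etrans (esym (total b)) F0.
apply: (@filterS2 _ _ (ae_filter_ringOfSetsType m) _ _ _ _ ae_torus fE).
by move=> x /andP[x0 x1] ->; rewrite -addrA rprimitive_arc ?x0 ?ltW.
Qed.

Lemma is_laplacian_linear c (f1 f2 g1 g2 : L2V V) :
  is_laplacian W f1 g1 -> is_laplacian W f2 g2 ->
  is_laplacian W (c *: f1 + f2) (c *: g1 + g2).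
Proof.
move=> /is_laplacianP[a1 [b1 r1]] /is_laplacianP[a2 [b2 r2]].
apply/is_laplacianP; exists (c * a1 + a2), (c * b1 + b2).
exact: (representation_linear c (L2V_integrable g1) (L2V_integrable g2) r1 r2).
Qed.

Lemma is_laplacian_sym (f1 f2 g1 g2 : L2V V) :
  is_laplacian W f1 g1 -> is_laplacian W f2 g2 -> inner f1 g2 = inner g1 f2.
Proof.
move=> /is_laplacianP[a1 [b1 r1]] /is_laplacianP[a2 [b2 r2]].
have [g10 _ _] := r1; have [g20 _ _] := r2.
have e1 := representation_green b2 (L2V_integrable g1) (L2V_integrable g2)
  (measurable_funPT f1) r1 g20.
have e2 := representation_green b1 (L2V_integrable g2) (L2V_integrable g1)
  (measurable_funPT f2) r2 g10.
rewrite [RHS]innerC; apply: (etrans e1); apply: etrans (esym e2).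
by congr (- _); apply: eq_Rintegral => y _; rewrite mulrC.
Qed.

End torus.

(** * Lower bound of the eigenvalues *)

(** Integrate [(M F - c)^2 >= 0], with [M] the mass of [E] and [c] the integral of [F]. This yields
    [M] times the claim, whence the separate case of a null set. *)
Lemma Rintegral_cauchy_schwarz d (T : measurableType d) (R : realType)
    (n : {finite_measure set T -> \bar R}) (E : set T) (F : T -> R) :
  measurable E -> n.-integrable E (EFin \o F) ->
  n.-integrable E (EFin \o (F \* F)) ->
  (\int[n]_(y in E) F y) ^+ 2 <= fine (n E) * \int[n]_(y in E) (F y * F y).
Proof.
move=> mE iF iFF; set c := Rintegral n E F; set M := fine (n E).
have M0 : 0 <= M by exact: fine_ge0.
have iM : n.-integrable E (EFin \o cst (c ^+ 2)).
  exact: finite_measure_integrable_cst.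
have iFF' : n.-integrable E (EFin \o (fun y => M ^+ 2 * (F y * F y))).
  exact: (integrableZl mE (M ^+ 2) iFF).
have iF' : n.-integrable E (EFin \o (fun y => - (2 * M * c) * F y)).
  exact: (integrableZl mE (- (2 * M * c)) iF).
have : 0 <= \int[n]_(y in E) ((M * F y - c) ^+ 2).
  by apply: Rintegral_ge0 => y _; exact: sqr_ge0.
have -> : \int[n]_(y in E) ((M * F y - c) ^+ 2) =
    M * (M * \int[n]_(y in E) (F y * F y) - c ^+ 2).
  transitivity (\int[n]_(y in E)
      (M ^+ 2 * (F y * F y) + - (2 * M * c) * F y + c ^+ 2)).
    by apply: eq_Rintegral => y _; ring.
  rewrite RintegralD//; last exact: (integrableD mE iFF' iF').
  rewrite RintegralD// RintegralZl// RintegralZl// Rintegral_cst//.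
  by rewrite -/c -/M; ring.
move: M0; rewrite le_eqVlt => /predU1P[M0 _|M0]; last by rewrite pmulr_rge0// subr_ge0.
suff -> : c = 0 by rewrite expr0n/= -M0 mul0r.
rewrite /c /Rintegral; have nE : n E = 0%E.
  by apply/eqP; rewrite -[n E]fineK ?fin_num_measure// -/M -M0.
by rewrite null_set_integral//; case/integrableP : iF.
Qed.

(** * A Poincaré inequality on a partition into cells *)

Section cells.
Context {R : realType}.
Local Notation T := (measurableTypeR R).
Variables (m n : {finite_measure set T -> \bar R}) (F : T -> R) (a : R).
Hypothesis iF : n.-integrable setT (EFin \o F).
Hypothesis iFF : n.-integrable setT (EFin \o (F \* F)).

Let iS (f : T -> R) (E : set T) : measurable E ->
  n.-integrable setT (EFin \o f) -> n.-integrable E (EFin \o f).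
Proof. by move=> mE; apply: integrableS. Qed.

Let u x := a + rprimitive n F x.

Let measurable_sqr_u E : measurable_fun E (fun x => (u x ^+ 2)%:E).
Proof.
apply/measurable_EFinP/measurable_funX.
apply: (@measurable_funS _ _ _ _ setT) => //.
by apply: measurable_funD => //; exact: (measurable_rprimitive m).
Qed.

Lemma rprimitiveB p t : p <= t ->
  rprimitive n F t - rprimitive n F p = \int[n]_(y in `]p, t]) F y.
Proof.
move=> pt; rewrite /rprimitive.
have -> : `]-oo, t]%classic = `]-oo, p] `|` `]p, t] :> set R.
  apply/seteqP; split => y /=; rewrite !in_itv/=.
    by move=> yt; have [h|h] := leP y p; [left|right].
  by move=> [/le_trans->//|/andP[_ ->]].
rewrite Rintegral_setU//; first by rewrite addrAC subrr add0r.
- by apply: iS => //; exact: measurableU.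
- apply/disj_setPS => y /=; rewrite !in_itv/= => -[yp /andP[py _]].
  by move: py; rewrite ltNge yp.
Qed.

Variable delta : R.

(** As [u p = 0], Cauchy-Schwarz gives [u t ^+ 2 <= delta * Q] inside the cell. The bound carries
    the indicator of the open cell, so that integrating it costs [m] of []p, q[] and not of [[p,
    q[]. *)
Lemma cell_estimate p q : u p = 0 ->
  (forall t, p < t < q -> fine (n `]p, t]%classic) <= delta) ->
  (m `]p, q[%classic <= delta%:E)%E ->
  (\int[m]_(x in `[p, q[) (u x ^+ 2)%:E <=
   (delta ^+ 2)%:E * \int[n]_(y in `]p, q]) (F y * F y)%:E)%E.
Proof.
move=> up nd md; pose Q := \int[n]_(y in `]p, q]) (F y * F y).
have iQ : (\int[n]_(y in `]p, q]) (F y * F y)%:E = Q%:E)%E.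
  by rewrite /Q /Rintegral fineK//; apply: integrable_fin_num => //; exact: iS.
have Q0 : 0 <= Q by apply: Rintegral_ge0 => y _; rewrite -expr2 sqr_ge0.
have d0 : 0 <= delta by rewrite -lee_fin (le_trans _ md).
have uQ t : p <= t < q -> u t ^+ 2 <= (delta * Q) * \1_(`]p, q[%classic) t.
  move=> /andP[pt tq]; move: pt; rewrite le_eqVlt => /predU1P[<-|pt].
    by rewrite up expr0n/= mulr_ge0// mulr_ge0.
  rewrite indicE mem_set ?mulr1; last by rewrite /= in_itv/= pt.
  have -> : u t = \int[n]_(y in `]p, t]) F y.
    rewrite -rprimitiveB ?ltW//; move: up; rewrite /u => /eqP.
    by rewrite addrC addr_eq0 => /eqP ->; rewrite opprK addrC.
  apply: le_trans (Rintegral_cauchy_schwarz _ _ _) _ => //; [exact: iS..|].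
  apply: ler_pM; [exact: fine_ge0| |by apply: nd; rewrite pt|].
    by apply: Rintegral_ge0 => y _; rewrite -expr2 sqr_ge0.
  rewrite -lee_fin -iQ /Rintegral fineK; last first.
    by apply: integrable_fin_num => //; exact: iS.
  apply: ge0_subset_integral => //.
  - have : measurable_fun setT (EFin \o (F \* F)) by case/integrableP : iFF.
    exact: measurable_funS.
  - by move=> y _; rewrite lee_fin -expr2 sqr_ge0.
  - by move=> y /=; rewrite !in_itv/= => /andP[-> /le_trans]; apply; exact: ltW.
apply: le_trans (_ : \int[m]_(x in `[p, q[)
  ((delta * Q)%:E * (\1_(`]p, q[%classic) x)%:E) <= _)%E.
  apply: ge0_le_integral => //.
  - by move=> x _; rewrite lee_fin sqr_ge0.
  - exact: measurable_sqr_u.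
  - by apply: measurable_funeM; apply/measurable_EFinP; exact: measurable_indic.
rewrite ge0_integralZl//; last 2 first.
- by apply/measurable_EFinP; exact: measurable_indic.
- by rewrite lee_fin mulr_ge0.
rewrite integral_indic// setIidl; last first.
  by move=> x /=; rewrite !in_itv/= => /andP[/ltW -> ->].
apply: (@le_trans _ _ ((delta * Q)%:E * delta%:E)%E).
  by apply: lee_wpmul2l => //; rewrite lee_fin mulr_ge0.
by rewrite iQ -!EFinM lee_fin expr2 mulrAC.
Qed.

(** Cells closed on the left for [m] and on the right for [n] tile without overlap, so the cell
    estimates add up. *)
Lemma cells_estimate (p : nat -> R) (N : nat) :
  (forall k, (k < N)%N -> p k <= p k.+1) ->
  (forall k, (k < N)%N -> u (p k) = 0) ->
  (forall k t, (k < N)%N -> p k < t < p k.+1 -> fine (n `]p k, t]%classic) <= delta) ->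
  (forall k, (k < N)%N -> (m `]p k, p k.+1[%classic <= delta%:E)%E) ->
  (\int[m]_(x in `[p 0%N, p N[) (u x ^+ 2)%:E <=
   (delta ^+ 2)%:E * \int[n]_(y in `]p 0%N, p N]) (F y * F y)%:E)%E.
Proof.
elim: N => [|N IH] pp up nd md.
  rewrite set_itvco0 ?integral_set0// set_itvoc0 ?integral_set0//.
  by rewrite mule0.
have p0N : p 0%N <= p N.
  elim: N pp {IH up nd md} => // N IH pp.
  by rewrite (le_trans (IH _))// ?pp// => k kN; rewrite pp// ltnW.
have mFF E : measurable_fun E (fun x => (F x * F x)%:E).
  have : measurable_fun setT (EFin \o (F \* F)) by case/integrableP : iFF.
  exact: measurable_funS.
have -> : `[p 0%N, p N.+1[%classic = `[p 0%N, p N[ `|` `[p N, p N.+1[ :> set R.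
  apply/seteqP; split => y /=; rewrite !in_itv/=.
    by move=> /andP[-> yN]; have [h|h] := ltP y (p N); [left|right].
  move=> [/andP[-> /lt_le_trans->]|/andP[yN ->]]//; first exact: pp.
  by rewrite (le_trans p0N).
have -> : `]p 0%N, p N.+1]%classic = `]p 0%N, p N] `|` `]p N, p N.+1] :> set R.
  apply/seteqP; split => y /=; rewrite !in_itv/=.
    by move=> /andP[-> yN]; have [h|h] := leP y (p N); [left|right].
  move=> [/andP[-> /le_trans->]|/andP[yN ->]]//; first exact: pp.
  by rewrite (le_lt_trans p0N).
rewrite ge0_integral_setU//; last 3 first.
- exact: measurable_sqr_u.
- by move=> x _; rewrite lee_fin sqr_ge0.
- apply/disj_setPS => y /=; rewrite !in_itv/= => -[/andP[_ yN] /andP[]].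
  by rewrite leNgt yN.
rewrite ge0_integral_setU//; last 2 first.
- by move=> x _; rewrite lee_fin -expr2 sqr_ge0.
- apply/disj_setPS => y /=; rewrite !in_itv/= => -[/andP[_ yN] /andP[]].
  by rewrite ltNge yN.
rewrite ge0_muleDr; last 2 first.
- by apply: integral_ge0 => y _; rewrite lee_fin -expr2 sqr_ge0.
- by apply: integral_ge0 => y _; rewrite lee_fin -expr2 sqr_ge0.
apply: leeD.
  apply: IH => [k|k|k t|k] kN; have := ltnW kN;
    [exact: pp|exact: up|exact: nd|exact: md].
by apply: cell_estimate; [exact: up|move=> t; exact: nd|exact: md].
Qed.

End cells.

(** The vanishing conditions concern the representative [a + rprimitive n F], because [f] equals it
    only almost everywhere. *)
Lemma representation_poincare (R : realType)
    (m n : {finite_measure set (measurableTypeR R) -> \bar R})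
    (a b delta : R) (g f : measurableTypeR R -> R) (p : nat -> R) (N : nat) :
  m.-integrable setT (EFin \o g) -> m.-integrable setT (EFin \o (f \* f)) ->
  measurable_fun setT f -> representation m n a b g f ->
  {ae m, forall x : R, p 0%N <= x < p N} ->
  (forall k, (k < N)%N -> p k <= p k.+1) ->
  (forall k, (k < N)%N -> a + rprimitive n (flux m b g) (p k) = 0) ->
  (forall k t, (k < N)%N -> p k < t < p k.+1 ->
    fine (n `]p k, t]%classic) <= delta) ->
  (forall k, (k < N)%N -> (m `]p k, p k.+1[%classic <= delta%:E)%E) ->
  \int[m]_x (f x * f x) <= delta ^+ 2 * \int[n]_y (flux m b g y * flux m b g y).
Proof.
move=> ig iff mf [_ _ fE] aep pp up nd md; set F := flux m b g.
have iF : n.-integrable setT (EFin \o F) by exact: integrable_flux.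
have iFF : n.-integrable setT (EFin \o (F \* F)) by exact: integrable_flux_mul.
have mu : measurable_fun setT (fun x => (a + rprimitive n F x) ^+ 2).
  by apply/measurable_funX/measurable_funD => //; exact: (measurable_rprimitive m).
have mFF : measurable_fun setT (fun y => (F y * F y)%:E) by case/integrableP : iFF.
have EI (k : {finite_measure set (measurableTypeR R) -> \bar R}) h :
    k.-integrable setT (EFin \o h) ->
    ((\int[k]_x h x)%:E = \int[k]_x (h x)%:E)%E.
  by move=> ih; rewrite /Rintegral fineK//; exact: integrable_fin_num.
rewrite -lee_fin EFinM (EI m (f \* f))// (EI n (F \* F))//.
apply: le_trans (_ : _ <=
  (delta ^+ 2)%:E * \int[n]_(y in `]p 0%N, p N]) (F y * F y)%:E)%E _; last first.
  apply: lee_wpmul2l; first by rewrite lee_fin sqr_ge0.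
  by apply: ge0_subset_integral => // y _; rewrite lee_fin -expr2 sqr_ge0.
apply: le_trans (cells_estimate iF iFF pp up nd md).
rewrite [leRHS]integral_mkcond le_eqVlt; apply/orP; left; apply/eqP.
apply: ae_eq_integral => //.
- by case/integrableP : iff.
- apply/(measurable_restrictT _ _).1 => //.
  by apply/measurable_EFinP; exact: measurable_funS mu.
- apply: filterS2 fE aep => x fx xp _ /=.
  by rewrite fx patchE mem_set ?expr2// /= in_itv/=.
Qed.

(** * A mesh adapted to the growth of [W + V] *)

Section mesh.
Context {R : realType}.
Variables (W : cumulative R R) (V : lcumulative R).
Hypotheses (W0 : W 0 = 0) (V0 : V 0 = 0).
Hypothesis V_increasing : {homo V : x y / x < y}.
Local Notation T := (measurableTypeR R).
Local Notation dW := (lebesgue_stieltjes_measure W).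
Local Notation dV := (left_stieltjes_measure V).

Let W_nd : {homo W : x y / x <= y}.
Proof. exact: cumulative_is_nondecreasing. Qed.

Let S x := W x + V x.

Let S_lt x y : x < y -> S x < S y.
Proof. by move=> xy; rewrite ler_ltD// ?V_increasing// W_nd// ltW. Qed.

Let S_le x y : x <= y -> S x <= S y.
Proof. by rewrite le_eqVlt => /predU1P[->//|/S_lt/ltW]. Qed.

Let S1_gt0 : 0 < S 1.
Proof. by have := S_lt ltr01; rewrite /S W0 V0 addr0. Qed.

(** [dV] is explicit on intervals closed on the left, so the open interval is exhausted by [[p + 1 /
    (k + 1), q[]; [0 <= d] covers those that are empty. *)
Lemma left_stieltjes_measure_itvoo (p q d : R) :
  (forall y, p < y < q -> V q - V y <= d) -> 0 <= d ->
  (dV `]p, q[%classic <= d%:E)%E.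
Proof.
move=> Vd d0.
pose F k := `[p + k.+1%:R^-1, q[%classic : set T.
have -> : `]p, q[%classic = \bigcup_k F k by rewrite itv_open_bnd_bigcup.
have ndF : nondecreasing_seq F.
  move=> i j ij; apply/subsetPset => y; rewrite /F/= !in_itv/= => /andP[+ ->].
  rewrite andbT; apply: le_trans; rewrite lerD2l lef_pV2 ?posrE//.
  by rewrite ler_nat.
have mF k : measurable (F k) by exact: measurable_itv.
have := nondecreasing_cvg_mu mF (bigcup_measurable (fun k _ => mF k)) ndF => /(_ _ dV).
move=> /cvg_lim <-//; apply: lime_le.
  apply: ereal_nondecreasing_is_cvgn => i j ij /=.
  by apply: le_measure; rewrite ?inE//; exact/subsetPset/ndF.
apply: nearW => k /=; rewrite /F.
have [pkq|qpk] := ltP (p + k.+1%:R^-1) q; last first.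
  rewrite set_itv_ge ?bnd_simp -?leNgt//.
  by rewrite measure0 lee_fin.
rewrite left_stieltjes_measure_itv ?(ltW pkq)// lee_fin Vd//.
by rewrite pkq ltrDl invr_gt0 ltr0n.
Qed.

Section points.
Variable N : nat.
Hypothesis N_gt0 : (0 < N)%N.

Definition mesh_size : R := S 1 / N%:R.
Let delta := mesh_size.

Let N0 : 0 < N%:R :> R. Proof. by rewrite ltr0n. Qed.

Let delta0 : 0 <= delta. Proof. by rewrite divr_ge0// ltW. Qed.

(** [S] may jump over the value [k * delta], so a mesh point is the infimum of a superlevel set and
    not a solution of an equation. Several mesh points may coincide, and the open cell between them
    is then empty. *)
Let level k := [set x | 0 <= x <= 1 /\ k%:R * delta <= S x].

(* On an open cell the increments of both [W] and [V] are at most [mesh_size];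
   an atom of [dV] at a mesh point does not matter since the test functions
   vanish there. *)
Definition mesh k := inf (level k).

Let level1 k : (k <= N)%N -> level k 1.
Proof.
move=> kN; split; first by rewrite ler01 lexx.
by rewrite /delta /mesh_size mulrCA ler_piMr ?(ltW S1_gt0)// ler_pdivrMr// mul1r ler_nat.
Qed.

Let level_lb k : has_lbound (level k).
Proof. by exists 0 => x [/andP[]]. Qed.

Let mesh_le k x : level k x -> mesh k <= x.
Proof. exact: ge_inf. Qed.

Let mesh_ge0 k : (k <= N)%N -> 0 <= mesh k.
Proof.
move=> kN; apply: lb_le_inf; first by exists 1; exact: level1.
by move=> x [/andP[]].
Qed.

Let mesh_le1 k : (k <= N)%N -> mesh k <= 1.
Proof. by move=> kN; apply/mesh_le/level1. Qed.

Lemma mesh0 : mesh 0 = 0.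
Proof.
apply/eqP; rewrite eq_le mesh_ge0// andbT; apply: mesh_le; split.
  by rewrite lexx ler01.
by rewrite mul0r /S W0 V0 addr0.
Qed.

(** The top level is [S 1], which the strictly increasing [S] reaches on [[0, 1]] at 1 only. *)
Lemma meshN : mesh N = 1.
Proof.
apply/eqP; rewrite eq_le mesh_le1//=; apply: lb_le_inf.
  by exists 1; exact: level1.
move=> x [/andP[_ x1]]; rewrite /delta /mesh_size mulrCA divff ?gt_eqF// mulr1.
by rewrite !leNgt; apply: contra => /S_lt.
Qed.

Lemma mesh_nd k : (k < N)%N -> mesh k <= mesh k.+1.
Proof.
move=> kN; apply: lb_le_inf; first by exists 1; exact: level1.
move=> x [x01 Sx]; apply: mesh_le; split=> //; apply: le_trans Sx.
by rewrite ler_wpM2r// ler_nat.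
Qed.

(** The infimum need not be attained, [S] being neither left- nor right-continuous in general; the
    level is thus secured only strictly to the right of the mesh point. *)
Let S_gt_mesh k y : (k < N)%N -> mesh k < y -> k%:R * delta <= S y.
Proof.
move=> kN; rewrite -subr_gt0 => ky.
have [|x [_ Sx]] := inf_adherent ky (E := level k).
  by split; [exists 1; apply/level1/ltnW|exact: level_lb].
by rewrite subrKC => /ltW/S_le; exact: le_trans.
Qed.

Let S_lt_mesh k y : (k < N)%N -> mesh k <= y -> y < mesh k.+1 ->
  S y <= k.+1%:R * delta.
Proof.
move=> kN ky yk; rewrite leNgt; apply: contraTN yk => Sy; rewrite -leNgt.
have y0 : 0 <= y by rewrite (le_trans _ ky)// mesh_ge0// ltnW.
have [y1|y1] := leP y 1; last by rewrite ltW// (le_lt_trans (mesh_le1 kN)).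
by apply: mesh_le; split; [rewrite y0 y1|exact: ltW].
Qed.

Let S_mesh k y z : (k < N)%N -> mesh k < y -> y <= z -> z < mesh k.+1 ->
  S z - S y <= delta.
Proof.
move=> kN ky yz zk; have h1 := S_gt_mesh kN ky.
have h2 := S_lt_mesh kN (le_trans (ltW ky) yz) zk.
by rewrite (le_trans (lerB h2 h1))// -mulrBl -natr1 addrAC subrr add0r mul1r.
Qed.

(** Within the open cell [S] grows by at most [delta], hence so does [W], the growth of [V] being
    nonnegative. Right continuity of [W] extends the bound to the left end point. *)
Lemma W_mesh k t : (k < N)%N -> mesh k < t < mesh k.+1 ->
  W t - W (mesh k) <= delta.
Proof.
move=> kN /andP[kt tk]; rewrite lerBlDr -lerBlDl.
have cW : W @ (mesh k)^'+ --> W (mesh k) by exact: cumulative_is_right_continuous.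
apply: (cvgr_to_ge cW).
near=> y.
have ky : mesh k < y by [].
have yt : y <= t by near: y; exact: nbhs_right_le.
have := S_mesh kN ky yt tk; have := @lcumulative_nondecreasing _ V _ _ yt.
by rewrite /S; lra.
Unshelve. all: end_near.
Qed.

(** Mirror image of [W_mesh]: left continuity of [V] reaches the right end point. *)
Lemma V_mesh k y : (k < N)%N -> mesh k < y < mesh k.+1 ->
  V (mesh k.+1) - V y <= delta.
Proof.
move=> kN /andP[ky yk]; rewrite lerBlDr.
have cV : V @ (mesh k.+1)^'- --> V (mesh k.+1).
  exact: lcumulative_left_continuous.
apply: (cvgr_to_le cV).
near=> z.
have zk : z < mesh k.+1 by [].
have yz : y <= z by near: z; exact: nbhs_left_ge.
have := S_mesh kN ky yz zk; have := W_nd yz.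
by rewrite /S; lra.
Unshelve. all: end_near.
Qed.

Lemma dV_mesh k : (k < N)%N ->
  (dV `]mesh k, mesh k.+1[%classic <= mesh_size%:E)%E.
Proof.
by move=> kN; apply: left_stieltjes_measure_itvoo => // y; exact: V_mesh.
Qed.

Lemma dW_mesh k t : (k < N)%N -> mesh k < t < mesh k.+1 ->
  (dW `]mesh k, t]%classic <= mesh_size%:E)%E.
Proof.
move=> kN kt; have /andP[/ltW kt' _] := kt.
by rewrite lebesgue_stieltjes_measure_itv// lee_fin; exact: W_mesh.
Qed.

End points.
End mesh.

Lemma Rintegral_eq0 d (T : measurableType d) (R : realType)
    (mu : {measure set T -> \bar R}) (D : set T) (f : T -> R) :
  (forall x, f x = 0) -> \int[mu]_(x in D) f x = 0.
Proof.
by move=> f0; under eq_Rintegral do rewrite f0; rewrite /Rintegral integral0.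
Qed.

(** * Eigenfunctions vanishing at the mesh points *)

Section lower_bound.
Context {R : realType}.
Variables (W : cumulative R R) (V : lcumulative R).
Hypotheses (W0 : W 0 = 0) (V0 : V 0 = 0).
Hypothesis V_increasing : {homo V : x y / x < y}.
Local Notation T := (measurableTypeR R).
Local Notation dW := (lebesgue_stieltjes_measure W).
Local Notation dV := (left_stieltjes_measure V).
Local Notation m := (finite_measure_of (torus_measure_lty V)).
Local Notation n := (finite_measure_of (arc_measure_lty W)).
Local Notation L2V := (L2V V).

(** Here [u] is the everywhere defined representative of [f], on which point values make sense. As a
    relation it passes to linear combinations without any choice of [a] and [b]. *)
Definition laplacian_potential (f g : L2V) (u : R -> R) := exists a b,
  representation m n a b g f /\ forall x, u x = a + rprimitive n (flux m b g) x.

Lemma laplacian_potential_exists f g : is_laplacian W f g ->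
  exists u, laplacian_potential f g u.
Proof.
move=> /(is_laplacianP W0)[a [b r]]; exists (fun x => a + rprimitive n (flux m b g) x).
by exists a, b.
Qed.

Lemma laplacian_potential_linear c f1 f2 g1 g2 u1 u2 :
  laplacian_potential f1 g1 u1 -> laplacian_potential f2 g2 u2 ->
  laplacian_potential (c *: f1 + f2) (c *: g1 + g2) (fun x => c * u1 x + u2 x).
Proof.
move=> [a1 [b1 [r1 u1E]]] [a2 [b2 [r2 u2E]]].
exists (c * a1 + a2), (c * b1 + b2); split.
  exact: (representation_linear c (L2V_integrable g1) (L2V_integrable g2) r1 r2).
move=> x; rewrite u1E u2E.
have -> := rprimitive_flux_linear n c b1 b2 x (L2V_integrable g1)
  (L2V_integrable g2).
by rewrite mulrDr addrACA.
Qed.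

Lemma laplacian_potential_cst (f : L2V) (c : R) : (forall x, f x = c) ->
  laplacian_potential f 0 (fun=> c).
Proof.
move=> fc; exists c, 0.
have F0 y : flux m 0 (0 : L2V) y = 0.
  by rewrite /flux /lprimitive add0r Rintegral_eq0.
have P0 x : rprimitive n (flux m 0 (0 : L2V)) x = 0 by exact: Rintegral_eq0.
split; last by move=> x; rewrite P0 addr0.
split; [exact: Rintegral_eq0|exact: Rintegral_eq0|].
by apply: aeW => x; rewrite P0 addr0.
Qed.

Lemma laplacian_potential_sum N (c : 'I_N -> R) (f g : 'I_N -> L2V)
    (u : 'I_N -> R -> R) :
  (forall i, laplacian_potential (f i) (g i) (u i)) ->
  laplacian_potential (\sum_i c i *: f i) (\sum_i c i *: g i)
    (fun x => \sum_i c i * u i x).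
Proof.
move=> fgu; elim: (index_enum _) => [|i r IH].
  rewrite !big_nil (_ : (fun=> _) = (fun=> 0)); last first.
    by apply/funext => x; rewrite big_nil.
  exact: laplacian_potential_cst.
rewrite !big_cons (_ : (fun=> _) = (fun x => c i * u i x +
  \sum_(j <- r) c j * u j x)); last by apply/funext => x; rewrite big_cons.
exact: laplacian_potential_linear.
Qed.

(** Poincaré's inequality on the mesh, with the integral of the squared flux rewritten as [- <f, g>]
    by Green's identity applied to [f] with itself. *)
Lemma laplacian_potential_energy f g u N : (0 < N)%N ->
  laplacian_potential f g u ->
  (forall k, (k < N)%N -> u (mesh W V N k) = 0) ->
  inner f f <= mesh_size W V N ^+ 2 * - inner f g.
Proof.
move=> N0 [a [b [r uE]]] u0.
have ig := L2V_integrable g; have [g0 _ _] := r.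
have e := representation_green b ig ig (measurable_funPT f) r g0.
have -> : inner f g = - \int[n]_y (flux m b g y * flux m b g y) by apply: (etrans e).
rewrite opprK.
apply: (representation_poincare (p := mesh W V N) (N := N) ig (integrable_inner f f)
  (measurable_funPT f) r).
- rewrite (mesh0 W0 V0 V_increasing N0) (meshN W0 V0 V_increasing N0).
  exact: ae_torus.
- by move=> k; exact: mesh_nd.
- by move=> k kN; rewrite -uE u0.
- move=> k t kN kt; rewrite -lee_fin fineK; last exact: fin_num_measure.
  apply: le_trans (dW_mesh W0 V0 V_increasing N0 kN kt).
  exact: (@le_mrestr _ _ _ dW _ _ (measurable_itv `]0%R, 1%R]) (measurable_itv _)).
- move=> k kN; apply: le_trans (dV_mesh W0 V0 V_increasing N0 kN).
  exact: (@le_mrestr _ _ _ dV _ _ (measurable_itv `[0%R, 1%R[) (measurable_itv _)).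
Qed.

Theorem eigenvalue_lower_bound (nu : nat -> L2V) (lam : nat -> R) N :
  orthonormal_seq nu -> (forall i, laplacian_eigenspace W (lam i) (nu i)) ->
  (forall i, (i <= N)%N -> lam i <= lam N) -> (0 < N)%N ->
  (N%:R / (W 1 + V 1)) ^+ 2 <= lam N.
Proof.
move=> onu enu lamN N0.
have /choice[u uP] i : exists u, laplacian_potential (nu i) (- lam i *: nu i) u.
  exact: laplacian_potential_exists (enu i).
(* One row per eigenfunction and one column per mesh point of index below [N]: the last mesh point
   is the left end of no cell. *)
have [c c0 ck] := exists_left_kernel
  (\matrix_(i < N.+1, k < N) u i (mesh W V N k)) (leqnn N.+1).
have onuN (i j : 'I_N.+1) : inner (nu i) (nu j) = (i == j)%:R by exact: onu.
have := @laplacian_potential_sum N.+1 (c 0) _ _ _ (fun i : 'I_N.+1 => uP i).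
move=> /(laplacian_potential_energy N0); set f := \sum_i _; set g := \sum_i _.
have -> : inner f f = \sum_i c 0 i ^+ 2.
  by rewrite inner_orthonormal_sum.
have -> : inner f g = - \sum_i c 0 i ^+ 2 * lam i.
  rewrite /g (eq_bigr (fun i : 'I_N.+1 => (- (c 0 i * lam i)) *: nu i)); last first.
    by move=> i _; rewrite scalerA mulrN.
  rewrite inner_orthonormal_sum// -sumrN; apply: eq_bigr => i _; ring.
rewrite opprK => h.
have s0 : 0 < \sum_i c 0 i ^+ 2.
  rewrite lt_def sumr_ge0 ?andbT => [|i _]; last exact: sqr_ge0.
  apply: contra c0; rewrite psumr_eq0 => [/allP c0|i _]; last exact: sqr_ge0.
  apply/eqP/rowP => i; rewrite mxE; apply/eqP.
  by have := c0 i (mem_index_enum i); rewrite sqrf_eq0.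
have S0 : 0 < W 1 + V 1.
  rewrite ltr_wpDl//; last by rewrite -V0 V_increasing.
  by rewrite -W0 cumulative_is_nondecreasing.
(* The Rayleigh quotient of [f] is a weighted mean of the [lam i] with [i <= N], hence at most
   [lam N]. *)
have : \sum_i c 0 i ^+ 2 <= mesh_size W V N ^+ 2 * (lam N * \sum_i c 0 i ^+ 2).
  apply: le_trans (h _) _ => [k kN|].
    have := congr1 (fun A : 'rV_N => A 0 (Ordinal kN)) ck.
    rewrite !mxE => ck0; apply: etrans ck0; apply: eq_bigr => i _.
    by rewrite mxE.
  rewrite ler_wpM2l ?sqr_ge0// mulr_sumr; apply: ler_sum => i _.
  by rewrite mulrC ler_wpM2r ?sqr_ge0// lamN// -ltnS.
rewrite mulrA -[leLHS]mul1r ler_pM2r// /mesh_size !expr_div_n.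
by rewrite mulrAC ler_pdivlMr ?exprn_gt0 ?ltr0n// mul1r mulrC ler_pdivrMr// exprn_gt0.
Qed.

End lower_bound.

(** * Orthonormal eigenfunctions *)

Section eigenfunctions.
Context {R : realType}.
Variables (W : cumulative R R) (V : lcumulative R).
Hypotheses (W0 : W 0 = 0) (V0 : V 0 = 0) (V1_gt0 : 0 < V 1).
Local Notation m := (finite_measure_of (torus_measure_lty V)).
Local Notation L2V := (L2V V).

Lemma is_laplacian_cst (f : L2V) c : (forall x, f x = c) -> is_laplacian W f 0.
Proof.
move=> fc; apply/(is_laplacianP W0).
by have [a [b [r _]]] := laplacian_potential_cst W fc; exists a, b.
Qed.

Lemma laplacian_eigenspace0 mu : laplacian_eigenspace W mu (0 : L2V).
Proof. by rewrite /laplacian_eigenspace/= scaler0; exact: (@is_laplacian_cst 0 0). Qed.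

Lemma laplacian_eigenspace_linear mu c (f g : L2V) :
  laplacian_eigenspace W mu f -> laplacian_eigenspace W mu g ->
  laplacian_eigenspace W mu (c *: f + g).
Proof.
move=> Ef Eg; rewrite /laplacian_eigenspace/= scalerDr scalerA mulrC -scalerA.
exact: (is_laplacian_linear W0 c Ef Eg).
Qed.

Lemma laplacian_eigenspace_orthogonal mu1 mu2 (f g : L2V) : mu1 != mu2 ->
  laplacian_eigenspace W mu1 f -> laplacian_eigenspace W mu2 g -> inner f g = 0.
Proof.
move=> m12 Ef Eg; have := is_laplacian_sym W0 Ef Eg.
rewrite innerZl innerZr !mulNr => /oppr_inj /eqP.
rewrite -subr_eq0 -mulrBl mulf_eq0 subr_eq0 eq_sym (negbTE m12) orFb.
by move/eqP.
Qed.

(** The multiplicity clause of [eigenvalue_sequence] concerns positive eigenvalues; index 0 is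
    served by this constant, [V 1] being the mass of the torus. *)
Lemma normalized_constant_exists : exists2 f : L2V,
  laplacian_eigenspace W 0 f & inner f f = 1.
Proof.
pose c := (Num.sqrt (V 1))^-1.
pose f : L2V := Lfun_Sub (lee1n 2) (Lfun_cst m c 2).
exists f.
  by rewrite /laplacian_eigenspace/= oppr0 scale0r; exact: (@is_laplacian_cst f c).
transitivity (\int[m]_(x in setT) (c * c)) => //.
rewrite Rintegral_cst// -expr2 exprVn sqr_sqrtr ?ltW//.
have mT : left_stieltjes_measure V (setT `&` `[0%R, 1%R[%classic) = (V 1)%:E.
  by rewrite setTI left_stieltjes_measure_itv// V0 subr0.
transitivity ((V 1)^-1 * fine (V 1)%:E); first by rewrite -mT.
by rewrite /= mulVf// gt_eqF.
Qed.

(** Each positive eigenvalue occurs in [lam] as often as its multiplicity, so its indices can label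
    an orthonormal family of its eigenspace; distinct eigenvalues have orthogonal eigenspaces. *)
Lemma orthonormal_eigenfunctions_exist (lam : nat -> R) :
  eigenvalue_sequence W V lam -> exists2 nu : nat -> L2V,
    orthonormal_seq nu & forall i, laplacian_eigenspace W (lam i) (nu i).
Proof.
move=> [lam0 lam_gt0 _ lamE].
have /choice[e eP] mu : exists e : nat -> L2V, 0 < mu ->
    (forall i, lam i = mu -> laplacian_eigenspace W mu (e i)) /\
    (forall i j, lam i = mu -> lam j = mu -> inner (e i) (e j) = (i == j)%:R).
  (* Values [mu <= 0] get a dummy sequence, the families being consulted at positive eigenvalues
     only. *)
  have [mu0|_] := ltP 0 mu; last by exists (fun=> 0).
  have [n /card_set_bijP[phi [phin phi_inj _]] [b [Eb free_b _]]] := lamE mu mu0.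
  have [e [Ee oe]] := exists_orthonormal_family (laplacian_eigenspace0 mu)
    (@laplacian_eigenspace_linear mu) Eb free_b (leqnn n).
  (* [phi] numbers the indices of the eigenvalue [mu] from 0 to [n - 1]; its injectivity preserves
     orthonormality. *)
  exists (e \o phi) => _; split=> [i imu|i j imu jmu] /=.
    exact/Ee/phin.
  rewrite oe ?phin//; congr (nat_of_bool _)%:R; apply/eqP/eqP => [|->//].
  by apply: phi_inj; rewrite inE.
have [f0 Ef0 f01] := normalized_constant_exists.
pose nu i := if i is 0%N then f0 else e (lam i) i.
have Enu i : laplacian_eigenspace W (lam i) (nu i).
  case: i => [|i]; first by rewrite lam0.
  by have [h _] := eP _ (lam_gt0 i.+1 isT); exact: h.
exists nu => // i j; have [lamij|lamij] := eqVneq (lam i) (lam j); last first.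
  have [ij|_] := eqVneq i j; first by rewrite ij eqxx in lamij.
  exact: (laplacian_eigenspace_orthogonal lamij (Enu i) (Enu j)).
case: i j lamij => [|i] [|j] lamij.
- by rewrite f01.
- by have := lam_gt0 j.+1 isT; rewrite -lamij lam0 ltxx.
- by have := lam_gt0 i.+1 isT; rewrite lamij lam0 ltxx.
- by have [_ h] := eP _ (lam_gt0 i.+1 isT); rewrite /nu -lamij h.
Qed.

End eigenfunctions.

(** Each term is at most [C^(-s) i^(-2 s)], and the exponent [2 s] exceeds 1. *)
Lemma sum_powRN_quadratic (R : realType) (lam : nat -> R) (C s : R) :
  0 < C -> 2^-1 < s -> (forall n, (0 < n)%N -> C * n%:R ^+ 2 <= lam n) ->
  exists M, forall n, \sum_(1 <= i < n) (lam i `^ s)^-1 <= M.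
Proof.
move=> C0 s2 lamC; have s0 : 0 < s by apply: lt_trans s2; rewrite invr_gt0.
have [M MP] := @sum_powRN_bounded R (2 * s) ltac:(lra).
exists ((C `^ s)^-1 * M) => n; rewrite big_add1 big_mkord.
apply: le_trans (_ : \sum_(i < n.-1) (C `^ s)^-1 * (i.+1%:R `^ (2 * s))^-1 <= _).
  apply: ler_sum => i _; rewrite -invfM lef_pV2 ?posrE; last 2 first.
  - by rewrite powR_gt0// (lt_le_trans _ (lamC _ _))// mulr_gt0// exprn_gt0.
  - by rewrite mulr_gt0 ?powR_gt0.
  rewrite powRrM -powRM ?powR_ge0 ?(ltW C0)// powR_mulrn//.
  rewrite ge0_ler_powR ?(ltW s0) ?nnegrE//; last exact: lamC.
    by rewrite mulr_ge0 ?(ltW C0)// sqr_ge0.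
  by rewrite (le_trans _ (lamC _ _))// mulr_ge0 ?(ltW C0)// sqr_ge0.
by rewrite -mulr_sumr ler_wpM2l// invr_ge0 powR_ge0.
Qed.

Theorem theorem2p6p4 (R : realType) (W : cumulative R R) (V : lcumulative R)
  (W_increasing : {homo W : x y / x < y})
  (V_increasing : {homo V : x y / x < y})
  (W_periodic : forall x : R, W (x + 1) - W x = W 1 - W 0)
  (V_periodic : forall x : R, V (x + 1) - V x = V 1 - V 0)
  (W_continuous0 : {for 0, continuous W})
  (V_continuous0 : {for 0, continuous V})
  (W0 : W 0 = 0) (V0 : V 0 = 0)
  (lam : nat -> R) (lamP : eigenvalue_sequence W V lam) :
  exists rho : R,
    [/\ 0 < rho <= 2^-1,
        exists2 C : R, 0 < C &
          forall n : nat, (1 <= n)%N -> C * n%:R `^ (rho^-1) <= lam n,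
        forall s : R, rho < s ->
          (\sum_(1 <= i <oo) ((lam i `^ s)^-1)%:E < +oo)%E &
        forall s : R, rho < s ->
          (exists A : L2V V -> L2V V, is_resolvent_power W lam s A) /\
          (forall A : L2V V -> L2V V,
             is_resolvent_power W lam s A -> trace_class A)].
Proof.
have V1 : 0 < V 1 by rewrite -V0 V_increasing.
have S1 : 0 < W 1 + V 1 by rewrite addr_gt0// -W0 W_increasing.
have [nu onu enu] := orthonormal_eigenfunctions_exist W0 V0 V1 lamP.
have [lam0 lam_gt0 lam_nd _] := lamP.
have lam_ge0 i : 0 <= lam i by case: i => [|i]; [rewrite lam0|exact/ltW/lam_gt0].
pose C := (W 1 + V 1) ^- 2.
have C0 : 0 < C by rewrite invr_gt0 exprn_gt0.
have lamC n : (0 < n)%N -> C * n%:R ^+ 2 <= lam n.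
  move=> n0; rewrite mulrC -expr_div_n.
  apply: (eigenvalue_lower_bound W0 V0 V_increasing onu enu _ n0) => -[|i] iN.
    by rewrite lam0.
  exact: lam_nd.
(* The term of index 0 is 1; the other ones are at most [(lam i)^(-s)]. *)
have sumc s : 2^-1 < s -> exists M, forall n, \sum_(i < n) (1 + lam i) `^ (- s) <= M.
  move=> s2; have [M MP] := sum_powRN_quadratic C0 s2 lamC.
  have s0 : 0 <= s by apply: ltW; apply: lt_trans s2; rewrite invr_gt0.
  have M0 : 0 <= M by have := MP 0%N; rewrite big_geq.
  exists (1 + M) => -[|n]; first by rewrite big_ord0 addr_ge0.
  rewrite big_ord_recl lam0 addr0 powR1 lerD2l; apply: le_trans (MP n.+1).
  rewrite big_add1 big_mkord; apply: ler_sum => i _; rewrite powRN.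
  have li : 0 < lam i.+1 by exact: lam_gt0.
  rewrite lef_pV2 ?posrE ?powR_gt0 ?ltr_wpDl//.
  by rewrite ge0_ler_powR ?nnegrE ?addr_ge0// lerDr.
exists 2^-1; split.
- by rewrite invr_gt0 ltr0n lexx.
- exists C => // n n0; rewrite invrK powR_mulrn//; exact: lamC.
- move=> s /(sum_powRN_quadratic C0)/(_ lamC)[M MP].
  apply: le_lt_trans (ltry M); apply: nneseries_le_bound => // i.
  by rewrite invr_ge0 powR_ge0.
- move=> s /sumc[M cM]; have c0 i : 0 <= (1 + lam i) `^ (- s) by exact: powR_ge0.
  split.
    have /choice[A AP] := diagonal_operator_exists onu c0 cM.
    by exists A, nu.
  (* The family [nu'] attached to [A] may differ from [nu], but the coefficients are the same. *)
  move=> A [nu' [onu' _ AP]].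
  exact: (diagonal_operator_trace_class onu' c0 cM AP).
Qed.
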